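(* Let $X$ be a separable metrizable space. If the hyperspace $K(X)$ is hereditarily Baire, then the space $P_r(X)$ is hereditarily Baire too, and thus $P(X)$ is Baire.
   Context: $K(X)$ denotes the space of all nonempty compact subsets of $X$ with the Vietoris topology, whose basic open sets are $\langle U_0,\dots,U_n\rangle=\{K\in K(X): K\subseteq\bigcup_{i\le n}U_i \text{ and } K\cap U_i\ne\emptyset \text{ for every } i\le n\}$, with each $U_i$ open in $X$. A topological space is Baire if the intersection of every countable family of open dense subsets is dense; it is hereditarily Baire if every closed subspace is Baire. $P(X)$ is the space of all Borel probability measures on $X$ with the weak topology, in which basic neighborhoods of $\mu$ are the sets $\{\nu\in P(X):|\int f_i\,d\mu-\int f_i\,d\nu|<\varepsilon,\ i=1,\dots,n\}$ with $\varepsilon>0$ and $f_1,\dots,f_n$ bounded continuous real-valued functions on $X$. A measure $\mu\in P(X)$ is Radon if for each Borel set $B\subseteq X$ and each $\varepsilon>0$ there is a compact $K\subseteq B$ with $\mu(B\setminus K)<\varepsilon$. $P_r(X)$ is the subspace of $P(X)$ consisting of all Radon measures. *)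

(* Defs.v *)
From HB Require Import structures.
From mathcomp Require Import all_boot all_order all_algebra.
From mathcomp Require Import all_classical all_reals all_analysis.

Set Implicit Arguments.
Unset Strict Implicit.
Unset Printing Implicit Defensive.

Import Order.TTheory GRing.Theory Num.Theory.
Import numFieldTopology.Exports numFieldNormedType.Exports.

Local Open Scope classical_set_scope.
Local Open Scope ring_scope.

Definition separable (X : topologicalType) : Prop :=
  exists2 D : set X, countable D & dense D.

Definition metrizable (R : realType) (X : topologicalType) : Prop :=
  exists d : X -> X -> R,
    [/\ forall x y, d x y = 0 <-> x = y,
        forall x y, d x y = d y x,
        forall x y z, d x z <= d x y + d y z &
        forall x : X,
          nbhs x = filter_from [set e | 0 < e] (fun e => [set y | d x y < e])].

Definition baire_space (T : topologicalType) : Prop :=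
  forall U : nat -> set T,
    (forall n, open (U n) /\ dense (U n)) -> dense (\bigcap_n U n).

(* The coercion of [A] to a type carries the subspace topology (the initial
   topology of the inclusion), unlike the library's [subspace A]. *)
Definition hereditarily_baire (T : topologicalType) : Prop :=
  forall A : set T, closed A -> baire_space (set_type A).

(* Built with [set_type] only for its choice structure: the topology is the
   Vietoris topology given below, not an initial topology from [set X]. *)
Definition hyperspace (X : topologicalType) : Type :=
  set_type [set K : set X | compact K /\ K !=set0].

HB.instance Definition _ (X : topologicalType) := Choice.on (hyperspace X).

Section vietoris.
Context {X : topologicalType}.
Implicit Types (nU : nat * (nat -> set X)) (K : hyperspace X).

(* The pair [(n, U)] stands for the family [U 0, ..., U n]; the remaining
   values of [U] are ignored. *)
Definition vietoris_index : set (nat * (nat -> set X)) :=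
  [set nU | forall i, (i <= nU.1)%N -> open (nU.2 i)].

Definition vietoris_basic nU : set (hyperspace X) :=
  [set K | set_val K `<=` \bigcup_(i in [set i | (i <= nU.1)%N]) nU.2 i /\
           forall i, (i <= nU.1)%N -> set_val K `&` nU.2 i !=set0].

Lemma vietoris_cover : \bigcup_(nU in vietoris_index) vietoris_basic nU = setT.
Proof.
apply/seteqP; split=> // K _; exists (0%N, fun=> setT).
  by move=> i _; exact: openT.
have [_ K0] := set_valP K.
split=> [x Kx|i _]; first by exists 0%N.
by rewrite setIT.
Qed.

Lemma vietoris_join nU nV K : vietoris_index nU -> vietoris_index nV ->
  vietoris_basic nU K -> vietoris_basic nV K ->
  exists nW, [/\ vietoris_index nW, vietoris_basic nW K &
    vietoris_basic nW `<=` vietoris_basic nU `&` vietoris_basic nV].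
Proof.
case: nU => n U; case: nV => m V; rewrite /vietoris_index /vietoris_basic /=.
move=> oU oV [KU KUi] [KV KVi].
pose CU := \bigcup_(i in [set i | (i <= n)%N]) U i.
pose CV := \bigcup_(i in [set i | (i <= m)%N]) V i.
have oCU : open CU by apply: bigcup_open.
have oCV : open CV by apply: bigcup_open.
pose W i := if (i <= n)%N then U i `&` CV else V (i - n.+1)%N `&` CU.
have WU i : (i <= n)%N -> W i = U i `&` CV by rewrite /W => ->.
have WV i : W (n.+1 + i)%N = V i `&` CU.
  by rewrite /W leqNgt addSn ltnS leq_addr /= -addSn addKn.
have sub i : (i <= n.+1 + m)%N ->
    (i <= n)%N \/ exists2 j, (j <= m)%N & i = (n.+1 + j)%N.
  move=> inm; have [|ni] := leqP i n; [by left|right].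
  by exists (i - n.+1)%N; [rewrite leq_subLR|rewrite subnKC].
exists ((n.+1 + m)%N, W); split=> /=.
- move=> i /sub[ni|[j jm ->]].
    by rewrite WU//; apply: openI => //; exact: oU.
  by rewrite WV; apply: openI => //; exact: oV.
- split=> [x Kx|i /sub[ni|[j jm ->]]].
  + have [i /= ni Ux] := KU _ Kx; exists i => /=.
      by rewrite (leq_trans ni)// ltnW// ltnS leq_addr.
    by rewrite WU//; split=> //; exact: KV.
  + have [x [Kx Ux]] := KUi _ ni; exists x; split=> //.
    by rewrite WU//; split=> //; exact: KV.
  + have [x [Kx Vx]] := KVi _ jm; exists x; split=> //.
    by rewrite WV; split=> //; exact: KU.
- move=> L [/= LW LWi]; split; split=> /=.
  + move=> x /LW[i /= /sub[ni|[j jm ->]]].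
      by rewrite WU// => -[Ux _]; exists i.
    by rewrite WV => -[].
  + move=> i ni; have [|x] := LWi i.
      by rewrite (leq_trans ni)// ltnW// ltnS leq_addr.
    by rewrite WU// => -[Lx [Ux _]]; exists x.
  + move=> x /LW[i /= /sub[ni|[j jm ->]]].
      by rewrite WU// => -[].
    by rewrite WV => -[Vx _]; exists j.
  + move=> i im; have [|x] := LWi (n.+1 + i)%N; first by rewrite leq_add2l.
    by rewrite WV => -[Lx [Vx _]]; exists x.
Qed.

HB.instance Definition _ := isBaseTopological.Build (hyperspace X)
  vietoris_cover (fun nU nV K => @vietoris_join nU nV K).

End vietoris.

(* Measurable types are inhabited in the library, hence [ptopologicalType]; the
   distinguished point of X plays no other role. *)
Definition borel_type (X : ptopologicalType) : measurableType _ :=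
  g_sigma_algebraType (@open X).

(* An inhabitant is a function on all subsets of X; its values outside the
   Borel sets are unconstrained. Two inhabitants that agree on the Borel sets
   have the same integrals, so they have the same neighborhoods below and
   represent the same point. *)
Definition borel_probability (R : realType) (X : ptopologicalType) : Type :=
  probability (borel_type X) R.

HB.instance Definition _ (R : realType) (X : ptopologicalType) :=
  Choice.on (borel_probability R X).

Section weak_topology.
Context {R : realType} {X : ptopologicalType}.
Implicit Types (nfe : nat * (nat -> X -> R) * R) (mu nu : borel_probability R X).

Definition borel_integral mu (f : X -> R) : R :=
  \int[(mu : probability (borel_type X) R)]_x f x.

(* The triple [(n, f, e)] stands for the functions [f 0, ..., f (n - 1)] and
   the radius [e]. *)
Definition weak_index : set (nat * (nat -> X -> R) * R) :=
  [set nfe | 0 < nfe.2 /\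
     forall i, (i < nfe.1.1)%N ->
       continuous (nfe.1.2 i) /\ exists M, forall x, `|nfe.1.2 i x| <= M].

Definition weak_basic mu nfe : set (borel_probability R X) :=
  [set nu | forall i, (i < nfe.1.1)%N ->
     `|borel_integral mu (nfe.1.2 i) - borel_integral nu (nfe.1.2 i)| < nfe.2].

Definition weak_nbhs mu : set_system (borel_probability R X) :=
  filter_from weak_index (weak_basic mu).

HB.instance Definition _ := hasNbhs.Build (borel_probability R X) weak_nbhs.

Lemma weak_basic_refl mu nfe : weak_index nfe -> weak_basic mu nfe mu.
Proof. by move=> [e0 _] i _; rewrite subrr normr0. Qed.

Lemma weak_nbhs_filter mu : ProperFilter (weak_nbhs mu).
Proof.
apply: filter_from_proper; last first.
  by move=> nfe Infe; exists mu; exact: weak_basic_refl.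
apply: filter_from_filter; first by exists (0%N, fun=> 0, 1); split.
move=> [[n f] e] [[m g] r] [/= e0 If] [/= r0 Ig].
pose h i := if (i < n)%N then f i else g (i - n)%N.
exists ((n + m)%N, h, Num.min e r).
  split=> /= [|i inm]; first by rewrite lt_min e0 r0.
  rewrite /h; case: ltnP => ni; first exact: If.
  by apply: Ig; rewrite ltn_subLR.
move=> nu /= hnu; split=> i /= im.
- have := hnu i; rewrite /= /h im lt_min => /(_ (ltn_addr _ im)).
  by case/andP.
- have := hnu (n + i)%N; rewrite /= /h ltn_add2l im ltnNge leq_addr /=.
  by rewrite addKn lt_min => /(_ isT)/andP[].
Qed.

Lemma weak_nbhs_singleton mu (A : set (borel_probability R X)) :
  weak_nbhs mu A -> A mu.
Proof. by move=> [nfe Infe]; apply; exact: weak_basic_refl. Qed.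

Lemma weak_nbhs_nbhs mu (A : set (borel_probability R X)) :
  weak_nbhs mu A -> weak_nbhs mu (weak_nbhs^~ A).
Proof.
move=> [[[n f] e] [/= e0 If] muA].
exists (n, f, e / 2); first by split=> //=; rewrite divr_gt0.
move=> nu /= munu; exists (n, f, e / 2); first by split=> //=; rewrite divr_gt0.
move=> xi /= nuxi; apply: muA => i /= ni.
rewrite -(subrKA (borel_integral nu (f i))) (le_lt_trans (ler_normD _ _))//.
by rewrite [ltRHS]splitr ltrD//; [exact: munu|exact: nuxi].
Qed.

HB.instance Definition _ := Nbhs_isNbhsTopological.Build (borel_probability R X)
  weak_nbhs_filter weak_nbhs_singleton weak_nbhs_nbhs.

Definition radon : set (borel_probability R X) :=
  [set mu | forall B : set X, @measurable _ (borel_type X) B ->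
     forall e : R, 0 < e ->
     exists K : set X, [/\ compact K, K `<=` B &
       ((mu : probability (borel_type X) R) (B `\` K) < e%:E)%E]].

End weak_topology.

Definition radon_probability (R : realType) (X : ptopologicalType)
  : topologicalType := set_type (@radon R X).

(* Main.v *)
(* Let A be closed in P_r(X), with relatively open dense subsets U_i.  Grow a tree
   of measures in A indexed by finite sequences of naturals, the depth of a node
   taking care of the U_i.  Each node carries, for every k, a compact set K^k of
   mass > 1 - 1/(k+1); a child s.j is chosen weakly close to s, so that for k <= j
   its K^k and those of its descendants lie in the 1/(j+1)-thickening of the K^k
   of s.  Therefore the union L^k_n of the sets K^k up to depth n is compact.

   If L_n is an increasing sequence of nonempty compact sets, then for some f the
   sets L_n \cap \bigcap_(m < n) thick(L_m, f m) lie in one compact set: otherwise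
   such sets, with finite sequences in place of f, would form a countable closed
   crowded subset of K(X).  Applied to every L^k this gives functions f_k, and a
   single branch dominating all of them is uniformly tight.  Its measures then
   have a Radon cluster point, which lies in A and in every U_i.

   The cluster point is the regularization of the ultrafilter limit of the
   measures: the outer measure of an open set is the supremum of the limits over
   its compact subsets, and Caratheodory's theorem applies to Borel sets.

   Finally P_r(X) is dense in P(X), because the image of a measure under a Borel
   map of finite range is Radon, and a space with a dense Baire subspace is Baire. *)
From HB Require Import structures.
Require Import Defs.
From mathcomp Require Import all_boot all_order all_algebra.
From mathcomp Require Import all_classical all_reals all_analysis.
From mathcomp Require Import measurable_realfun finmap lra.

Set Implicit Arguments.
Unset Strict Implicit.
Unset Printing Implicit Defensive.

Import Order.TTheory GRing.Theory Num.Theory.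
Import numFieldTopology.Exports numFieldNormedType.Exports.

Local Open Scope classical_set_scope.
Local Open Scope ring_scope.

(** * Metric thickenings of compact sets *)

Section metric.
Context {R : realType} {X : ptopologicalType} {d : X -> X -> R}.

Definition compatible_metric : Prop :=
  [/\ forall x y, d x y = 0 <-> x = y,
      forall x y, d x y = d y x,
      forall x y z, d x z <= d x y + d y z &
      forall x : X,
        nbhs x = filter_from [set e | 0 < e] (fun e => [set y | d x y < e])].

(* [dist set0 x = 0], because the infimum of the empty set is [0]: most facts
   below need [K !=set0]. *)
Definition dist (K : set X) (x : X) : R := inf [set d y x | y in K].

Definition cthick (K : set X) (j : nat) : set X :=
  [set x | dist K x <= j.+1%:R^-1].

Definition thick (K : set X) (j : nat) : set X :=
  [set x | dist K x < j.+1%:R^-1].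

Context (dP : compatible_metric).
Implicit Types (K L : set X).

Lemma metric_ge0 x y : 0 <= d x y.
Proof.
case: dP => d0 dC dT _; have := dT x y x.
rewrite (dC y x) (iffRL (d0 x x) erefl); lra.
Qed.

Lemma metric_xx x : d x x = 0.
Proof. by case: dP => d0 _ _ _; apply/d0. Qed.

Lemma metric_nbhsP x (A : set X) :
  nbhs x A <-> exists2 e : R, 0 < e & forall y, d x y < e -> A y.
Proof. by case: dP => _ _ _ ->; split => -[e e0 eA]; exists e. Qed.

Lemma dist_lbound K x : has_lbound [set d y x | y in K].
Proof. by exists 0 => _ [y _ <-]; exact: metric_ge0. Qed.

Lemma dist_le K x y : K y -> dist K x <= d y x.
Proof. by move=> Ky; apply: ge_inf; [exact: dist_lbound|exists y]. Qed.

Lemma dist_in K x : K x -> dist K x <= 0.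
Proof. by move=> Kx; rewrite -(metric_xx x); exact: dist_le. Qed.

Lemma dist_lt K x e : K !=set0 -> dist K x < e -> exists2 y, K y & d y x < e.
Proof.
move=> [y Ky] Ke; have ne : [set d y x | y in K] !=set0 by exists (d y x), y.
by have [_ [z Kz <-] ze] := inf_lt ne Ke; exists z.
Qed.

Lemma dist_subset K L x : K !=set0 -> K `<=` L -> dist L x <= dist K x.
Proof.
move=> [y Ky] KL; apply: lb_le_inf; first by exists (d y x), y.
by move=> _ [z Kz <-]; exact/dist_le/KL.
Qed.

Lemma dist_triangle K x y : K !=set0 -> dist K x <= dist K y + d y x.
Proof.
move=> [z Kz]; rewrite -lerBlDr; apply: lb_le_inf; first by exists (d z y), z.
move=> _ [t Kt <-]; rewrite lerBlDr; case: dP => _ _ dT _.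
by apply: le_trans (dT _ y _); exact: dist_le.
Qed.

Lemma dist_continuous K : K !=set0 -> continuous (dist K).
Proof.
move=> K0 x; apply/cvgrPdist_lt => e e0; near=> y.
have : d x y < e by near: y; apply/metric_nbhsP; exists e.
have := dist_triangle x y K0; have := dist_triangle y x K0.
have [_ -> _ _] := dP; rewrite distrC ltr_norml; lra.
Unshelve. all: by end_near. Qed.

Lemma thick_open K j : K !=set0 -> open (thick K j).
Proof.
move=> /dist_continuous/continuousP/(_ `]-oo, j.+1%:R^-1[%classic).
rewrite (_ : _ @^-1` _ = thick K j).
  by apply; exact: interval_open.
by apply/seteqP; split=> x /=; rewrite in_itv.
Qed.

Lemma cthick_closed K j : K !=set0 -> closed (cthick K j).
Proof.
move=> /dist_continuous/continuous_closedP/(_ `]-oo, j.+1%:R^-1]%classic).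
rewrite (_ : _ @^-1` _ = cthick K j).
  by apply; exact: interval_closed.
by apply/seteqP; split=> x /=; rewrite in_itv.
Qed.

Lemma sub_thick K j : K `<=` thick K j.
Proof. by move=> x /dist_in Kx; rewrite /thick/= (le_lt_trans Kx). Qed.

Lemma thick_cthick K j : thick K j `<=` cthick K j.
Proof. by move=> x /ltW. Qed.

Lemma sub_cthick K j : K `<=` cthick K j.
Proof. by move=> x /(@sub_thick K j)/thick_cthick. Qed.

Lemma thick_subset K L i j : K !=set0 -> K `<=` L -> (i <= j)%N ->
  thick K j `<=` thick L i.
Proof.
move=> K0 KL ij x Kx; rewrite /thick/= (le_lt_trans (dist_subset _ K0 KL))//.
by rewrite (lt_le_trans Kx)// lef_pV2 ?posrE// ler_nat.
Qed.

Lemma cthick_decr K i j : (i <= j)%N -> cthick K j `<=` cthick K i.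
Proof.
move=> ij x /= Kx; rewrite /cthick/= (le_trans Kx)//.
by rewrite lef_pV2 ?posrE// ler_nat.
Qed.

(** A radius that is good at a point of [K] is good on a neighborhood of that point, so by
    compactness one radius serves all of [K]. *)
Lemma compact_cthick K O : K !=set0 -> compact K -> open O -> K `<=` O ->
  exists j, cthick K j `<=` O.
Proof.
move=> K0 /compact_near_coveringP cK oO KO.
(* The factor 2 is slack: the infimum defining [dist] need not be attained. *)
have /= := cK _ _ (fun j y => forall z, d y z <= j.+1%:R^-1 *+ 2 -> O z) _ _.
move=> /(_ \oo _ _)[].
  move=> x Kx; have /metric_nbhsP[e e0 xO] : nbhs x O.
    by apply: open_nbhs_nbhs; split=> //; exact: KO.
  have e4 : 0 < e / 4 by rewrite divr_gt0.
  near=> y j => z yz; apply: xO.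
  have : d x y < e / 4 by near: y; apply/metric_nbhsP; exists (e / 4).
  have : j.+1%:R^-1 < e / 4 by near: j; exact: near_infty_natSinv_lt (PosNum e4).
  case: dP => _ _ dT _; have := dT x y z; move: yz; rewrite mulr2n.
  by move: j.+1%:R^-1 => r; lra.
move=> N _ /(_ N (leqnn N)) NO; exists N => x Kx.
have [|y Ky yx] := @dist_lt K x (N.+1%:R^-1 *+ 2) K0.
  by rewrite (le_lt_trans Kx)// mulr2n ltrDl invr_gt0.
by apply: NO Ky _ (ltW yx).
Unshelve. all: by end_near. Qed.

Lemma metric_hausdorff : hausdorff_space X.
Proof.
have [d0 dC dT _] := dP.
move=> x y xy; apply/d0/eqP; rewrite eq_le metric_ge0 andbT leNgt.
apply/negP => e0; have e2 : 0 < d x y / 2 by rewrite divr_gt0.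
have [z []] : [set z | d x z < d x y / 2] `&` [set z | d y z < d x y / 2] !=set0.
  by apply: xy; apply/metric_nbhsP; exists (d x y / 2).
move=> /= xz yz; have := dT x z y; rewrite (dC z y); lra.
Qed.

Lemma metric_compact_closed K : compact K -> closed K.
Proof. by apply: compact_closed; exact: metric_hausdorff. Qed.

Lemma metric_closed1 (x : X) : closed ([set x] : set X).
Proof. exact/accessible_closed_set1/hausdorff_accessible/metric_hausdorff. Qed.

Lemma metric_urysohn K O : compact K -> K !=set0 -> open O -> K `<=` O ->
  exists f : X -> R, [/\ continuous f, forall x, 0 <= f x <= 1,
    forall x, K x -> f x = 1 & forall x, ~ O x -> f x = 0].
Proof.
move=> cK K0 oO KO; have [j jO] := compact_cthick K0 cK oO KO.
(* A tent function: 1 on [K], falling to 0 at distance 1/(j+1), where [O] has not been left yet.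
   Truncating the distance at 0 makes the upper bound 1 immediate. *)
exists (cst 0 \max (cst 1 \- cst j.+1%:R \* (cst 0 \max dist K))); split.
- move=> x; apply: continuous_max; first exact: cvg_cst.
  apply: continuousB; first exact: cvg_cst.
  apply: continuousM; first exact: cvg_cst.
  apply: continuous_max; first exact: cvg_cst.
  exact: dist_continuous.
- move=> x /=; rewrite le_max lexx/= ge_max ler01/= gerBl.
  by rewrite mulr_ge0// le_max lexx.
- move=> x /dist_in Kx /=; rewrite (max_l Kx) mulr0 subr0 max_r//.
- move=> x nOx /=; have : j.+1%:R^-1 < dist K x.
    by rewrite ltNge; apply/negP => /jO.
  move=> jx; rewrite [Num.max 0 (dist K x)]max_r; last first.
    by rewrite (le_trans _ (ltW jx)).
  by rewrite max_l// subr_le0 -ler_pdivrMl ?mulr1 ?ltW.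
Qed.

(** A finite subcover of [K] already covers some [cthick d K j], hence every [C i] with i >= max(j,
    m); only finitely many compact sets remain. *)
Lemma compact_bigcup_thick K (C : nat -> set X) m : compact K -> K !=set0 ->
  (forall j, compact (C j)) -> (forall j, (m <= j)%N -> C j `<=` thick K j) ->
  compact (K `|` \bigcup_j C j).
Proof.
move=> cK K0 cC CK; rewrite compact_cover => I D f fop fcov.
have : cover_compact K by rewrite -compact_cover.
move=> /(_ I D f fop)[|D1 D1D KD1]; first by move=> x Kx; apply: fcov; left.
have oD1 : open (cover [set` D1] f).
  by apply: bigcup_open => i iD1; apply: fop; exact/set_mem/D1D.
have [j jD1] := compact_cthick K0 cK oD1 KD1.
pose N := maxn j m.
have cN : compact (\bigcup_(i < N) C i).
  by rewrite bigcup_mkord; apply: bigsetU_compact => i _; exact: cC.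
have : cover_compact (\bigcup_(i < N) C i) by rewrite -compact_cover.
move=> /(_ I D f fop)[|D2 D2D ND2].
  by move=> x [i _ Cx]; apply: fcov; right; exists i.
exists (D1 `|` D2)%fset.
  by move=> i; rewrite inE => /orP[/D1D|/D2D].
have sub1 : cover [set` D1] f `<=` cover [set` (D1 `|` D2)%fset] f.
  by apply: bigcup_subset => i /= iD1; rewrite inE iD1.
have sub2 : cover [set` D2] f `<=` cover [set` (D1 `|` D2)%fset] f.
  by apply: bigcup_subset => i /= iD2; rewrite inE iD2 orbT.
move=> x [/KD1/sub1//|[i _ Cx]].
have [iN|Ni] := ltnP i N; first by apply/sub2/ND2; exists i.
have mi : (m <= i)%N by rewrite (leq_trans _ Ni)// leq_maxr.
apply/sub1/jD1/thick_cthick.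
apply: (@thick_subset K K j i) => //; last exact: CK.
by rewrite (leq_trans _ Ni)// leq_maxl.
Qed.

End metric.
Arguments dist {R X} d.
Arguments thick {R X} d.
Arguments cthick {R X} d.
Arguments compatible_metric {R X} d.
(** * Compact branches in the hyperspace *)

Lemma filter_forall_ltn (T : Type) (F : set_system T) (P : nat -> set T) n :
  Filter F -> (forall i, (i < n)%N -> F (P i)) ->
  F [set x | forall i, (i < n)%N -> P i x].
Proof.
move=> FF; elim: n => [|n IHn] FP; first by apply: filterS filterT.
apply: filterS (filterI (FP n (ltnSn n)) (IHn _)) => [x [Pn Pi] i|i ni].
  by rewrite ltnS leq_eqVlt => /predU1P[->//|/Pi].
by apply: FP; rewrite ltnW.
Qed.

Lemma set_type_open (T : topologicalType) (A : set T) (O : set (set_type A)) :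
  open O <-> exists2 U : set T, open U & O = set_val @^-1` U.
Proof. by split=> [[U oU <-]|[U oU ->]]; exists U. Qed.

Lemma hereditarily_baireP (T : topologicalType) :
  hereditarily_baire T <->
  forall (A : set T) (U : nat -> set T), closed A ->
    (forall n, open (U n)) ->
    (forall n O, open O -> A `&` O !=set0 -> A `&` O `&` U n !=set0) ->
    forall O, open O -> A `&` O !=set0 -> A `&` O `&` \bigcap_n U n !=set0.
Proof.
split=> [hB A U cA oU dU O oO [x [Ax Ox]]|hB A cA U dU].
  have [] := hB A cA (fun n => set_val @^-1` U n) _ (set_val @^-1` O).
  - move=> n; split; first by apply/set_type_open; exists (U n).
    move=> V [y Vy] /set_type_open[W oW VW]; rewrite {}VW in Vy *.
    have [|z [[Az Wz] Uz]] := dU n _ oW.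
      by exists (set_val y); split=> //; exact: set_valP.
    by exists (exist _ z (mem_set Az)).
  - by exists (exist _ x (mem_set Ax)).
  - by apply/set_type_open; exists O.
  move=> y [Oy Uy]; exists (set_val y); split; first split=> //.
    exact: set_valP.
  by move=> n _; exact: Uy.
have /choice[V VP] : forall n, exists V : set T, open V /\ U n = set_val @^-1` V.
  by move=> n; have [/set_type_open[V oV ->] _] := dU n; exists V.
move=> O [x Ox] /set_type_open[W oW OW]; rewrite {}OW in Ox *.
have [|||y [[Ay Wy] Vy]] := hB A V cA _ _ W oW.
- by move=> n; have [] := VP n.
- move=> n S oS [y [Ay Sy]]; have [_ dUn] := dU n.
  have [||z [Sz Uz]] := dUn (set_val @^-1` S).
  + by exists (exist _ y (mem_set Ay)).
  + by apply/set_type_open; exists S.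
  exists (set_val z); split; first by split=> //; exact: set_valP.
  by have [_ UV] := VP n; rewrite UV in Uz.
- by exists (set_val x); split=> //; exact: set_valP.
exists (exist _ y (mem_set Ay)); split=> // n _.
by have [_ ->] := VP n; exact: Vy.
Qed.

Section vietoris_topology.
Context {X : topologicalType}.
Implicit Types (C : hyperspace X) (U : set X).

Lemma vietoris_openP (O : set (hyperspace X)) C : open O -> O C ->
  exists nU, [/\ vietoris_index nU, vietoris_basic nU C & vietoris_basic nU `<=` O].
Proof.
move=> [D Dsub <-] [nU DnU CnU]; exists nU; split=> //; first exact: Dsub.
by move=> K ?; exists nU.
Qed.

Lemma vietoris_basic_open nU : vietoris_index nU ->
  open (vietoris_basic nU : set (hyperspace X)).
Proof.
move=> InU; exists [set nU]; first by move=> _ ->.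
by rewrite bigcup_set1.
Qed.

Lemma vietoris_open_inside U : open U ->
  open [set C : hyperspace X | set_val C `<=` U].
Proof.
move=> oU; have /vietoris_basic_open : vietoris_index (0%N, fun=> U) by [].
congr (open _); apply/seteqP; split=> C /= => [[CU _]|CU].
  by move=> x /CU[].
have [_ [x Cx]] := set_valP C.
split=> [y /CU Uy|i _]; first by exists 0%N.
by exists x; split=> //; exact: CU.
Qed.

Lemma vietoris_open_hit U : open U ->
  open [set C : hyperspace X | set_val C `&` U !=set0].
Proof.
move=> oU.
have /vietoris_basic_open :
    vietoris_index (1%N, fun i => if i == 0%N then setT else U).
  by case=> [|i] _ //=; exact: openT.
congr (open _); apply/seteqP; split=> C /= => [[_ /(_ 1%N isT)]//|CU].
split=> [x _|[|i] _ //=]; first by exists 0%N.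
by rewrite setIT; have [] := set_valP C.
Qed.

(** [C] differs from [K] when it hits the open complement of [K], or lies in the open complement of
    some point of [K]. *)
Lemma vietoris_open_neq K : (forall x : X, closed ([set x] : set X)) ->
  closed (set_val K) -> open [set C : hyperspace X | C != K].
Proof.
move=> cX cK.
pose V := [set C : hyperspace X | set_val C `&` ~` set_val K !=set0].
pose W x := [set C : hyperspace X | set_val C `<=` ~` [set x]].
rewrite (_ : mkset _ = V `|` \bigcup_(x in set_val K) W x).
  apply: openU; first exact/vietoris_open_hit/closed_openC.
  by apply: bigcup_open => x _; exact/vietoris_open_inside/closed_openC.
apply/seteqP; split=> C /=.
  move=> /eqP CK; have [CsubK|/existsNP[x /not_implyP[Cx Kx]]] :=
    pselect (set_val C `<=` set_val K); last by left; exists x.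
  right; apply: contrapT => nW; apply/CK/val_inj/seteqP; split=> // x Kx.
  by apply: contrapT => Cx; apply: nW; exists x => // y Cy /= yx; rewrite yx in Cy.
move=> [[x [Cx Kx]]|[x Kx CK]]; apply/eqP => eCK; first by rewrite eCK in Cx.
by rewrite eCK in CK; exact: (CK x).
Qed.

End vietoris_topology.

Lemma mkseqD (T : Type) (f : nat -> T) m n :
  mkseq f (m + n) = mkseq f m ++ mkseq (fun i => f (m + i)%N) n.
Proof.
rewrite /mkseq iotaD map_cat add0n -[in X in iota X n](addn0 m) iotaDl.
by rewrite -map_comp.
Qed.

Section compact_branch.
Context {R : realType} {X : ptopologicalType} {d : X -> X -> R}.
Context (dP : compatible_metric d).
Context (L : nat -> set X) (cL : forall n, compact (L n)) (L0 : L 0 !=set0).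
Context (LS : forall n, L n `<=` L n.+1).
Implicit Types s t : seq nat.

Let Lmono m n : (m <= n)%N -> L m `<=` L n.
Proof. by elim: n => [|n IHn]; [rewrite leqn0 => /eqP->|
  rewrite leq_eqVlt => /predU1P[->//|/IHn mn] x /mn/LS]. Qed.

Let Lneq0 n : L n !=set0.
Proof. by have [x Lx] := L0; exists x; exact: Lmono Lx. Qed.

(* For [t] extending [rcons s j], the sets [M t] contain [M s] and shrink to it
   as [j] grows: in K(X), the points [M s] form a tree in which the children of
   a node converge to it, together with all their descendants. *)
Let F s := [set x | forall m, (m < size s)%N -> cthick d (L m) (nth 0%N s m) x].

Let M s := L (size s) `&` F s.

Let F_closed s : closed (F s).
Proof.
rewrite (_ : F s = \bigcap_(m < size s) cthick d (L m) (nth 0%N s m)).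
  by apply: closed_bigI => m _; exact: cthick_closed.
by apply/seteqP; split=> x Fx m; exact: Fx.
Qed.

Let M_compact s : compact (M s).
Proof. exact: compact_closedI. Qed.

Let M_cat s t : M s `<=` M (s ++ t).
Proof.
move=> x [Lx Fx]; split; first by apply: Lmono Lx; rewrite size_cat leq_addr.
move=> m _; rewrite nth_cat; case: ltnP => [|sm]; first exact: Fx.
by apply: sub_cthick => //; exact: Lmono Lx.
Qed.

Let M_neq0 s : M s !=set0.
Proof.
have [x Lx] := L0; exists x; apply: (@M_cat [::] s).
by split.
Qed.

(** [O] and the complement of [F s] together form an open set around [L (size s)], so they cover a
    closed thickening of it, of index [J] say. Below [rcons s j] all points lie in [F s] and in the
    thickening of index [j]. *)
Let M_near s O : open O -> M s `<=` O ->
  exists J, forall j t, (J <= j)%N -> M (rcons s j ++ t) `<=` O.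
Proof.
move=> oO MO.
have [|||J LJ] := @compact_cthick _ _ _ dP (L (size s)) (O `|` ~` F s) _ (@cL _).
- exact: Lneq0.
- by apply: openU => //; exact: closed_openC.
- by move=> x Lx; have [Fx|] := pselect (F s x); [left; exact: MO|right].
exists J => j t Jj x [_ Fx].
have /LJ[//|] : cthick d (L (size s)) J x.
  apply: (cthick_decr Jj); have := Fx (size s).
  rewrite size_cat size_rcons nth_cat size_rcons nth_rcons ltnn eqxx ltnSn.
  by rewrite ltn_addr// => /(_ isT).
case=> m ms; have := Fx m; rewrite size_cat size_rcons nth_cat size_rcons.
by rewrite nth_rcons ms (leqW ms) (ltn_addr _ (leqW ms)) => /(_ isT).
Qed.

Let M_hyper s : [set K : set X | compact K /\ K !=set0] (M s).
Proof. by split. Qed.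

Let H s : hyperspace X := exist _ (M s) (mem_set (M_hyper s)).

Let cell s := closure [set H (s ++ t) | t in setT].

(** If [C] missed a point [x] of [M s], the compact sets avoiding [x] would form a neighborhood of
    [C] without nodes below [s], as all of these contain [M s]. *)
Let cell_sub s C : cell s C -> M s `<=` set_val C.
Proof.
move=> sC x Mx; apply: contrapT => nCx.
have /closed_openC/vietoris_open_inside oK := @metric_closed1 _ _ _ dP x.
have [|_ [[t _ <-] /(_ x)]] := sC [set K | set_val K `<=` ~` [set x]].
  by apply: open_nbhs_nbhs; split=> // y Cy /= yx; rewrite yx in Cy.
by move=> /(_ (M_cat _ Mx)); exact.
Qed.

(** [C] has a point outside a small thickening of [M s], whereas the subtrees of all but finitely
    many children lie inside it. Finitely many neighborhoods cannot separate [C] from all the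
    remaining subtrees. *)
Let cell_rcons s C : cell s C -> C <> H s -> exists j, cell (rcons s j) C.
Proof.
move=> sC CH; have MC := cell_sub sC.
have [x [Cx Mx]] : exists x, set_val C x /\ ~ M s x.
  apply: contrapT => nx; apply/CH/val_inj/seteqP; split=> // x Cx.
  by apply: contrapT => Mx; apply: nx; exists x.
have [|i Mi] := compact_cthick dP (M_neq0 s) (@M_compact s)
  (closed_openC (@metric_closed1 _ _ _ dP x)).
  by move=> y My /= yx; rewrite yx in My.
have [J MJ] := M_near (thick_open dP i (M_neq0 s)) (@sub_thick _ _ _ dP (M s) i).
apply: contrapT => /forallNP nC.
have /choice[N NP] : forall j, exists N, nbhs C N /\
    [set H (rcons s j ++ t) | t in setT] `&` N = set0.
  move=> j; apply: contrapT => nN; apply: (nC j) => N CN.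
  by apply/set0P/negP => /eqP N0; apply: nN; exists N.
(* Hitting [U] rules out [s] itself and every subtree of index at least [J]. *)
pose U := ~` cthick d (M s) i.
have oU : open U by apply: closed_openC; exact: cthick_closed.
have CU : nbhs C [set K | set_val K `&` U !=set0].
  apply: open_nbhs_nbhs; split; first exact: vietoris_open_hit.
  by exists x; split=> // /Mi; exact.
have CN := filter_forall_ltn (nbhs_filter C) (fun j (_ : (j < J)%N) => (NP j).1).
have [_ [[t _ <-] [[y [My Uy]] Nt]]] := sC _ (filterI CU CN).
case: t My Nt => [|j t] My Nt.
  by apply: Uy; apply: sub_cthick => //; rewrite cats0 in My.
rewrite -cat_rcons in My Nt; have [jJ|Jj] := ltnP j J.
  by have [_ /seteqP[+ _]] := NP j; apply; split; [exists t|exact: Nt].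
by apply: Uy; apply: thick_cthick; exact: MJ My.
Qed.

Let F_mkseq f n : F (mkseq f n) =
  [set x | forall m, (m < n)%N -> cthick d (L m) (f m) x].
Proof.
by apply/seteqP; split=> x Fx m; move: (Fx m); rewrite size_mkseq => + mn;
  rewrite nth_mkseq//; exact.
Qed.

Lemma compact_branch : hereditarily_baire (hyperspace X) ->
  exists f : nat -> nat, exists2 C : set X, compact C &
    forall n, L n `&` [set x | forall m, (m < n)%N -> cthick d (L m) (f m) x] `<=` C.
Proof.
move=> /hereditarily_baireP hB.
suff [f [C cC MC]] : exists f, exists2 C, compact C & forall n, M (mkseq f n) `<=` C.
  exists f, C => // n; rewrite -F_mkseq.
  by have := MC n; rewrite /M size_mkseq.
(* If [M s] is isolated in the closure of the tree, the tree is constant below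
   [rcons s J] and any branch through it will do; otherwise the complements of
   the points [M s] are dense in that closure. *)
have [[s [J sJ]]|ns] := pselect (exists s J, forall t, M (rcons s J ++ t) = M s).
  (* This branch follows [s] and then repeats [J]. Its sets increase, and from [rcons s J] on they
     equal [M s]. *)
  exists (nth J s), (M s) => // n.
  rewrite -(sJ (mkseq (fun i => nth J s ((size s).+1 + i)%N) n)).
  have -> : rcons s J = mkseq (nth J s) (size s).+1.
    by rewrite mkseqS mkseq_nth nth_default.
  by rewrite -mkseqD addnC mkseqD; exact: M_cat.
(* The nodes are enumerated by decoding numbers; a number that encodes no sequence contributes the
   whole space. *)
pose U n : set (hyperspace X) :=
  if @choice.unpickle (seq nat) n is Some s then [set C | C != H s] else setT.
have [||||C [[EC _] UC]] := hB (cell [::]) U _ _ _ setT openT.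
- exact: closed_closure.
- move=> n; rewrite /U; case: choice.unpickle => [s|]; last exact: openT.
  apply: vietoris_open_neq; first exact: (@metric_closed1 _ _ _ dP).
  by apply: (metric_compact_closed dP); exact: M_compact.
- move=> n O oO EO; rewrite /U; case: choice.unpickle => [s|]; last by rewrite setIT.
  (* [O] contains a node. If it is the excluded [H s], a descendant of a late child of [s] replaces
     it: it contains [M s], so it hits whatever [M s] hits, and it stays in the same open union. *)
  have [_ [[t _ <-] Ot]] : [set H ([::] ++ t) | t in setT] `&` O !=set0.
    by have [C [EC OC]] := EO; apply: EC; exact: open_nbhs_nbhs.
  rewrite /= in Ot; have cellH u : cell [::] (H u).
    by apply: subset_closure; exists u.
  have [Hts|Hts] := eqVneq (H t) (H s); last by exists (H t).
  rewrite Hts in Ot; have [[n' V] [/= oV [MV MVi] VO]] := vietoris_openP oO Ot.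
  have [|J MJ] := @M_near s _ _ MV; first exact: bigcup_open.
  have [u Hu] : exists u, M (rcons s J ++ u) <> M s.
    by apply/existsNP => sJ; apply: ns; exists s, J.
  exists (H (rcons s J ++ u)); split; last first.
    by apply/eqP => /(congr1 set_val).
  split=> //; apply: VO; split=> [|i /MVi[x [Mx Vx]]] /=; first exact: MJ.
  by exists x; split=> //; rewrite cat_rcons; exact: M_cat.
- by exists (H [::]); split=> //; apply: subset_closure; exists [::].
have CH s : C <> H s.
  by have /= := UC (choice.pickle s) I; rewrite /U choice.pickleK => /eqP.
(* A limit [C] of the tree that is none of its nodes lies on a branch, and it
   contains every [M s] of that branch. *)
have /choice[h hP] : forall s, exists j, cell s C -> cell (rcons s j) C.
  move=> s; have [sC|] := pselect (cell s C); last by exists 0%N.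
  by have [j sj] := cell_rcons sC (CH s); exists j.
pose fix br n := if n is m.+1 then rcons (br m) (h (br m)) else [::].
exists (fun n => h (br n)), (set_val C); first by have [] := set_valP C.
move=> n; suff [-> brC] : mkseq (fun n => h (br n)) n = br n /\ cell (br n) C.
  exact: cell_sub.
elim: n => [|n [IHn nC]]; first by [].
by rewrite mkseqS IHn; split=> //; exact: hP.
Qed.

End compact_branch.
(** * Borel probability measures *)

Section borel_probability_theory.
Context {R : realType} {X : ptopologicalType}.
Implicit Types (mu nu : borel_probability R X) (A B U : set X).

Definition borel A : Prop := @measurable _ (borel_type X) A.

Definition mass mu A : R := fine ((mu : probability (borel_type X) R) A).

Lemma open_borel U : open U -> borel U.
Proof. exact: sub_sigma_algebra. Qed.

Lemma closed_borel A : closed A -> borel A.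
Proof. by move=> /closed_openC/open_borel/measurableC; rewrite setCK. Qed.

Lemma massE mu A : borel A -> (mu : probability (borel_type X) R) A = (mass mu A)%:E.
Proof. by move=> mA; rewrite /mass fineK// fin_num_measure. Qed.

Lemma mass_ge0 mu A : 0 <= mass mu A.
Proof. exact/fine_ge0/measure_ge0. Qed.

Lemma mass_le1 mu A : borel A -> mass mu A <= 1.
Proof. by move=> mA; rewrite -lee_fin -massE// probability_le1. Qed.

Lemma mass0 mu : mass mu set0 = 0.
Proof. by rewrite /mass measure0. Qed.

Lemma massT mu : mass mu setT = 1.
Proof. exact: (congr1 fine (@probability_setT _ (borel_type X) R mu)). Qed.

Lemma massU mu A B : borel A -> borel B -> A `&` B = set0 ->
  mass mu (A `|` B) = mass mu A + mass mu B.
Proof.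
move=> mA mB AB0; apply/EFin_inj; rewrite EFinD -!massE//.
  by rewrite measureU.
exact: measurableU.
Qed.

Lemma le_mass mu A B : borel A -> borel B -> A `<=` B -> mass mu A <= mass mu B.
Proof.
move=> mA mB AB; rewrite -lee_fin -!massE//.
by apply: le_measure => //; exact: mem_set.
Qed.

Lemma continuous_borel (f : X -> R) : continuous f ->
  measurable_fun (setT : set (borel_type X)) (f : borel_type X -> R).
Proof.
move=> /continuousP cf; apply: (measurability _ (RGenOpens.measurableE R)).
move=> _ [_ [a [b ->] <-]]; rewrite setTI; apply: open_borel.
exact/cf/interval_open.
Qed.

Lemma bounded_borel_integrable mu (f : X -> R) M :
  measurable_fun (setT : set (borel_type X)) (f : borel_type X -> R) ->
  (forall x, `|f x| <= M) ->
  (mu : probability (borel_type X) R).-integrable setT (EFin \o f).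
Proof.
move=> mf fM; apply: measurable_bounded_integrable => //.
  apply: le_lt_trans (ltry 1).
  exact: (@probability_le1 _ (borel_type X) R mu _ measurableT).
exists M; split; first exact: num_real.
by move=> N MN x _ /=; rewrite (le_trans (fM x))// ltW.
Qed.

Lemma integral_sum_indic mu (A : nat -> set X) n : (forall i, borel (A i)) ->
  let h x := \sum_(i < n) (\1_(A i) x : R) in
  (mu : probability (borel_type X) R).-integrable setT (EFin \o h) /\
  borel_integral mu h = \sum_(i < n) mass mu (A i).
Proof.
move=> mA /=.
have Ai i : (mu : probability (borel_type X) R).-integrable setT
    (EFin \o (\1_(A i) : X -> R)).
  apply: (@bounded_borel_integrable mu _ 1) => [|x].
    exact: (@measurable_indic _ (borel_type X) R setT (A i) (mA i)).
  by rewrite indicE ger0_norm// lern1 leq_b1.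
elim: n => [|n [IH1 IH2]].
  have -> : (fun x => \sum_(i < 0) (\1_(A i) x : R)) = cst 0.
    by apply/funext => x; rewrite big_ord0.
  split; first by apply: (@bounded_borel_integrable mu _ 0) => // x; rewrite normr0.
  by rewrite big_ord0 /borel_integral Rintegral_cst// mul0r.
have -> : (fun x => \sum_(i < n.+1) (\1_(A i) x : R)) =
    (fun x => \sum_(i < n) (\1_(A i) x : R) + \1_(A n) x).
  by apply/funext => x; rewrite big_ord_recr.
split.
  exact: (@integrableD _ (borel_type X) _ mu setT measurableT _ _ IH1 (Ai n)).
rewrite /borel_integral big_ord_recr/= -IH2.
rewrite (@RintegralD _ (borel_type X) _ mu setT _ _ measurableT IH1 (Ai n)).
congr (_ + _); rewrite /Rintegral /mass.
rewrite (@integral_indic _ (borel_type X) R mu setT measurableT _ (mA n)).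
by congr (fine (_ _)); exact: setIT.
Qed.

Lemma mass_le_integral mu A (f : X -> R) : borel A -> continuous f ->
  (forall x, 0 <= f x <= 1) -> (forall x, A x -> f x = 1) ->
  mass mu A <= borel_integral mu f.
Proof.
move=> mA cf f01 fA.
have [I1 I2] := @integral_sum_indic mu (fun=> A) 1 (fun=> mA).
rewrite big_ord1 in I2; rewrite -I2; apply: le_Rintegral => //.
  apply: (@bounded_borel_integrable mu _ 1); first exact: continuous_borel.
  by move=> x; have /andP[f0 f1] := f01 x; rewrite ger0_norm.
move=> x _; rewrite big_ord1 indicE; case: (boolP (x \in A)) => xA.
  by rewrite fA//; exact/set_mem.
by have /andP[] := f01 x.
Qed.

Lemma integral_le_mass mu A (f : X -> R) : borel A -> continuous f ->
  (forall x, 0 <= f x <= 1) -> (forall x, ~ A x -> f x = 0) ->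
  borel_integral mu f <= mass mu A.
Proof.
move=> mA cf f01 fA.
have [I1 I2] := @integral_sum_indic mu (fun=> A) 1 (fun=> mA).
rewrite big_ord1 in I2; rewrite -I2; apply: le_Rintegral => //.
  apply: (@bounded_borel_integrable mu _ 1); first exact: continuous_borel.
  by move=> x; have /andP[f0 f1] := f01 x; rewrite ger0_norm.
move=> x _; rewrite big_ord1 indicE; case: (boolP (x \in A)) => xA.
  by have /andP[] := f01 x.
by rewrite fA// => /mem_set; exact/negP.
Qed.

(** The sum counts the positive multiples of [e] below [y]; the upper bound on [y] ensures that none
    is cut off. *)
Lemma layer_cake_bounds (e : R) n (y : R) : 0 < e -> 0 <= y <= n%:R * e ->
  e * (\sum_(i < n) ((i.+1%:R * e < y)%R : nat)%:R) <= y
  <= e * (\sum_(i < n) ((i.+1%:R * e < y)%R : nat)%:R) + e.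
Proof.
move=> e0; elim: n => [|n IHn] /andP[y0].
  by rewrite mul0r => y0'; rewrite big_ord0 mulr0 add0r y0/= (le_trans y0' (ltW e0)).
move=> yn; rewrite big_ord_recr/= [_ < y]ltNge yn/= addr0.
have [yn'|yn'] := leP y (n%:R * e); first by apply: IHn; rewrite y0.
rewrite (_ : \sum_(i < n) _ = n%:R); last first.
  rewrite (eq_bigr (fun=> 1)); first by rewrite sumr_const card_ord.
  move=> i _; rewrite (le_lt_trans _ yn')// ler_pM2r// ler_nat.
  exact: ltn_ord.
rewrite mulrC (ltW yn')/=; move: yn; rewrite -[n.+1]addn1 natrD; lra.
Qed.

(** Rounding [f + M], with values in [0, 2M], to multiples of [e] gives indicators of open
    superlevel sets. These do not depend on [mu], so inequalities between masses of open sets pass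
    to integrals. *)
Lemma integral_layer_cake (f : X -> R) (e M : R) n : 0 < e -> continuous f ->
  (forall x, `|f x| <= M) -> M *+ 2 <= n%:R * e ->
  exists2 A : nat -> set X, (forall i, open (A i)) &
  forall mu, e * (\sum_(i < n) mass mu (A i)) - M <= borel_integral mu f
             <= e * (\sum_(i < n) mass mu (A i)) - M + e.
Proof.
move=> e0 cf fM nM; pose A i := [set x | i.+1%:R * e - M < f x].
have oA i : open (A i).
  rewrite (_ : A i = f @^-1` `]i.+1%:R * e - M, +oo[%classic).
    by move: cf => /continuousP; apply; exact: interval_open.
  by apply/seteqP; split=> x; rewrite /A/= in_itv/= andbT.
exists A => // mu.
have [I1 I2] := @integral_sum_indic mu A n (fun i => open_borel (oA i)).
set h := (fun x => \sum_(i < n) _) in I1 I2.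
have fh x : e * h x - M <= f x <= e * h x + (e - M).
  have /= := @layer_cake_bounds e n (f x + M) e0.
  have := fM x; rewrite ler_norml => /andP[f1 f2] /(_ _)/wrap[].
    by move: nM; rewrite mulr2n; move: (n%:R * e) => r; lra.
  rewrite (_ : \sum_(i < n) _ = h x); first lra.
  apply: eq_bigr => i _; rewrite indicE; congr ((nat_of_bool _)%:R).
  by rewrite -ltrBlDr; apply/idP/idP => ?; [exact/mem_set|exact/set_mem].
pose P := (mu : probability (borel_type X) R).
have Icst c : P.-integrable setT (EFin \o (fun=> c)).
  by apply: (@bounded_borel_integrable mu _ `|c|).
have Ih : P.-integrable setT (EFin \o (fun x => e * h x)).
  exact: (@integrableZl _ (borel_type X) _ P setT measurableT e _ I1).
have ehE c : \int[P]_x (e * h x + c) = e * (\sum_(i < n) mass mu (A i)) + c.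
  rewrite (RintegralD measurableT Ih (Icst c)) Rintegral_cst//.
  rewrite (RintegralZl _ measurableT I1) -[fine _]/(mass mu setT) massT mulr1.
  by congr (e * _ + _).
have If : P.-integrable setT (EFin \o f).
  by apply: (@bounded_borel_integrable mu _ M) => //; exact: continuous_borel.
have Ihc c : P.-integrable setT (EFin \o (fun x => e * h x + c)).
  exact: (@integrableD _ (borel_type X) _ P setT measurableT _ _ Ih (Icst c)).
rewrite -addrA -ehE [- M + e]addrC -ehE; apply/andP; split.
  by apply: le_Rintegral => // x _; have /andP[] := fh x.
by apply: le_Rintegral => // x _; have /andP[] := fh x.
Qed.

End borel_probability_theory.
(** * Ultrafilter limits of tight sequences of measures *)

(** An ultrafilter converges to each of its cluster points. *)
Lemma ultrafilter_compact_cvg (T : topologicalType) (U : set_system nat)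
    (f : nat -> T) (K : set T) : UltraFilter U -> compact K ->
  (forall n, K (f n)) -> exists p : T, f @ U --> p.
Proof.
move=> UU cK Kf; have PU : ProperFilter U by exact: ultra_proper.
have [|p [_ pU]] := cK (f @ U) (fmap_proper_filter f PU).
  by apply: (@filterE _ U) => n; exact: Kf.
exists p => V pV.
have [//|nV] := in_ultra_setVsetC (f @^-1` V) UU.
by have [x []] := pU (~` V) V nV pV.
Qed.

Section limit_measure.
Context {R : realType} {X : ptopologicalType} {d : X -> X -> R}.
Context (dP : compatible_metric d).
Context (mu : nat -> borel_probability R X).
Context (U : set_system nat) (UU : UltraFilter U).
Implicit Types (A B G H K : set X).

Let PU : ProperFilter U. Proof. exact: ultra_proper. Qed.
Let KB K : compact K -> borel K.
Proof. by move=> cK; apply: closed_borel; exact: (metric_compact_closed dP). Qed.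

(* Not a measure: mass may escape from open sets in the limit, so that [ulim]
   is only finitely additive and is regularized from inside by compact sets. *)
Definition ulim A : R := lim (mass (mu n) A @[n --> U]).

Lemma ulim_cvg A : borel A -> mass (mu n) A @[n --> U] --> ulim A.
Proof.
move=> mA; have [||p fp] := @ultrafilter_compact_cvg R U
  (fun n => mass (mu n) A) `[0, 1]%classic UU; first exact: segment_compact.
  by move=> n; rewrite /= in_itv/= mass_ge0 mass_le1.
by rewrite /ulim (cvg_lim _ fp).
Qed.

Lemma ulim_ge A c : borel A -> U [set n | c <= mass (mu n) A] -> c <= ulim A.
Proof. by move=> mA; apply: limr_ge; exact: (cvgP _ (ulim_cvg mA)). Qed.

Lemma ulim_le1 A : borel A -> ulim A <= 1.
Proof.
move=> mA; apply: limr_le; first exact: (cvgP _ (ulim_cvg mA)).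
by apply: filterE => n; exact: mass_le1.
Qed.

Lemma le_ulim A B : borel A -> borel B -> A `<=` B -> ulim A <= ulim B.
Proof.
move=> mA mB AB; apply: ler_lim; [exact: (cvgP _ (ulim_cvg mA))|
  exact: (cvgP _ (ulim_cvg mB))|].
by apply: filterE => n; exact: le_mass.
Qed.

Lemma ulim0 : ulim set0 = 0.
Proof.
apply: cvg_lim => //; under eq_cvg do rewrite mass0.
exact: cvg_cst.
Qed.

Lemma ulimU A B : borel A -> borel B -> A `&` B = set0 ->
  ulim (A `|` B) = ulim A + ulim B.
Proof.
move=> mA mB AB; apply: cvg_lim => //.
under eq_cvg do rewrite massU//.
by apply: cvgD; exact: ulim_cvg.
Qed.

Lemma ulimU_le A B : borel A -> borel B -> ulim (A `|` B) <= ulim A + ulim B.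
Proof.
move=> mA mB; have mBA : borel (B `\` A) by exact: measurableD.
have -> : A `|` B = A `|` (B `\` A).
  apply/seteqP; split=> x [Ax|Bx]; try by left.
    by have [Ax|Ax] := pselect (A x); [left|right].
  by right; have [] := Bx.
by rewrite ulimU ?setDIK// lerD2l; apply: le_ulim => // x [].
Qed.

Definition inner G : \bar R :=
  ereal_sup [set (ulim K)%:E | K in [set K | compact K /\ K `<=` G]].

Definition outer A : \bar R :=
  ereal_inf [set inner G | G in [set G | open G /\ A `<=` G]].

Local Open Scope ereal_scope.

Lemma inner_ge K G : compact K -> K `<=` G -> (ulim K)%:E <= inner G.
Proof. by move=> cK KG; apply: ereal_sup_ubound; exists K. Qed.

Lemma inner_le G c : (forall K, compact K -> K `<=` G -> (ulim K)%:E <= c) ->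
  inner G <= c.
Proof. by move=> h; apply: ge_ereal_sup => _ [K [cK KG] <-]; exact: h. Qed.

Lemma inner_ge0 G : 0 <= inner G.
Proof. by rewrite -[0]/(0%:E) -ulim0; apply: inner_ge => //; exact: compact0. Qed.

Lemma inner_le1 G : inner G <= 1.
Proof. by apply: inner_le => K cK _; rewrite lee_fin; apply: ulim_le1; exact: KB. Qed.

Lemma le_inner G H : G `<=` H -> inner G <= inner H.
Proof. by move=> GH; apply: inner_le => K cK KG; apply: inner_ge => // x /KG/GH. Qed.

Lemma inner_le_ulim G : open G -> inner G <= (ulim G)%:E.
Proof.
move=> oG; apply: inner_le => K cK KG; rewrite lee_fin.
by apply: le_ulim => //; [exact: KB|exact: open_borel].
Qed.

(** The part of [K] outside [G] is compact inside [H], so a closed thickening of it stays in [H];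
    what [K] has outside the open thickening lies in [G]. *)
Lemma compact_split K G H : compact K -> open G -> open H -> K `<=` G `|` H ->
  exists K1 K2, [/\ compact K1, compact K2, K1 `<=` G, K2 `<=` H & K = K1 `|` K2].
Proof.
move=> cK oG oH KGH; have cD : compact (K `\` G).
  by apply: compact_closedI => //; exact: open_closedC.
have DH : K `\` G `<=` H by move=> x [/KGH[]].
(* The thickening of the empty set would be everything, as [dist] is 0 there. *)
have [D0|/set0P D0] := eqVneq (K `\` G) set0.
  exists K, set0; split=> //; [exact: compact0| |by rewrite setU0].
  by rewrite -setD_eq0.
have [j jH] := compact_cthick dP D0 cD oH DH.
exists (K `\` thick d (K `\` G) j), (K `&` cthick d (K `\` G) j); split.
- by apply: compact_closedI => //; apply: open_closedC; exact: thick_open.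
- by apply: compact_closedI => //; exact: cthick_closed.
- by move=> x [Kx nt]; apply: contrapT => nGx; apply: nt; exact: sub_thick.
- by move=> x [_ /jH].
apply/seteqP; split=> [x Kx|x [][]//].
have [xt|xt] := pselect (thick d (K `\` G) j x); last by left.
by right; split=> //; exact: thick_cthick.
Qed.

Lemma ulim_le_sum_inner (G : nat -> set X) n K : (forall i, open (G i)) ->
  compact K -> K `<=` \bigcup_(i < n) G i -> (ulim K)%:E <= \sum_(i < n) inner (G i).
Proof.
move=> oG; elim: n K => [|n IHn] K cK KG.
  rewrite big_ord0 (_ : K = set0) ?ulim0//.
  by rewrite bigcup_mkord big_ord0 in KG; apply/seteqP; split.
rewrite bigcup_mkord big_ord_recr/= -bigcup_mkord in KG.
have [|K1 [K2 [cK1 cK2 K1G K2G ->]]] := compact_split cK _ (oG n) KG.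
  exact: bigcup_open.
rewrite big_ord_recr/= (@le_trans _ _ ((ulim K1)%:E + (ulim K2)%:E))//.
  by rewrite -EFinD lee_fin; apply: ulimU_le; exact: KB.
by apply: leeD; [exact: IHn|exact: inner_ge].
Qed.

Lemma inner_bigcup (G : nat -> set X) : (forall i, open (G i)) ->
  inner (\bigcup_i G i) <= \sum_(i <oo) inner (G i).
Proof.
move=> oG; apply: inner_le => K cK KG.
have /compact_near_coveringP := cK.
move=> /(_ nat \oo (fun n x => exists2 i, (i < n)%N & G i x)).
move=> /(_ _ _)[] => [x /KG[i _ Gx]|N _ /(_ N (leqnn N)) KN].
  near=> y n; have ni : (i < n)%N by near: n; exact: nbhs_infty_gt.
  have Gy : G i y by near: y; apply: open_nbhs_nbhs.
  by exists i.
have /(ulim_le_sum_inner oG cK) : K `<=` \bigcup_(i < N) G i.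
  by move=> x /KN[i iN Gx]; exists i.
move=> /le_trans; apply; rewrite -(big_mkord xpredT (fun i => inner (G i))).
by apply: nneseries_lim_ge => n _ _; exact: inner_ge0.
Unshelve. all: by end_near. Qed.

Lemma outer_open G : open G -> outer G = inner G.
Proof.
move=> oG; apply/eqP; rewrite eq_le; apply/andP; split.
  by apply: ereal_inf_lbound; exists G => //; split.
by apply/ereal_infP => _ [H [_ GH] <-]; exact: le_inner.
Qed.

Lemma outer_le A G : open G -> A `<=` G -> outer A <= inner G.
Proof. by move=> oG AG; apply: ereal_inf_lbound; exists G. Qed.

Let outer_ge0 A : 0 <= outer A.
Proof. by apply/ereal_infP => _ [G _ <-]; exact: inner_ge0. Qed.

Lemma outer_le1 A : outer A <= 1.
Proof. exact: le_trans (outer_le openT (@subsetT _ A)) (inner_le1 _). Qed.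

Lemma outer_fin_num A : outer A \is a fin_num.
Proof. by rewrite ge0_fin_numE// (le_lt_trans (outer_le1 A)) ?ltry. Qed.

Let outer0 : outer set0 = 0.
Proof.
rewrite outer_open; last exact: open0.
apply/eqP; rewrite eq_le inner_ge0 andbT; apply: inner_le => K _ K0.
by rewrite (_ : K = set0) ?ulim0//; apply/seteqP; split.
Qed.

Let le_outer : {homo outer : A B / A `<=` B >-> A <= B}.
Proof.
move=> A B AB; apply/ereal_infP => _ [G [oG BG] <-].
by apply: outer_le => // x /AB/BG.
Qed.

Let outer_sigma_subadditive : sigma_subadditive outer.
Proof.
move=> F; apply/lee_addgt0Pr => e e0.
have /choice[G GP] : forall i, exists G, [/\ open G, F i `<=` G &
    inner G <= outer (F i) + (e / (2 ^ i.+1)%:R)%:E].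
  move=> i; have e2 : (0 < e / (2 ^ i.+1)%:R)%R by rewrite divr_gt0// ltr0n expn_gt0.
  have [_ [G [oG FG] <-] /ltW Gle] := lb_ereal_inf_adherent e2 (outer_fin_num (F i)).
  by exists G.
apply: (@le_trans _ _ (inner (\bigcup_i G i))).
  apply: outer_le; first by apply: bigcup_open => i _; have [] := GP i.
  by apply: subset_bigcup => i _; have [] := GP i.
apply: (le_trans (inner_bigcup _)); first by move=> i; have [] := GP i.
apply: le_trans (epsilon_trick _ _ (ltW e0)); last by move=> n; exact: outer_ge0.
apply: lee_nneseries => i _; [by move=> _; exact: inner_ge0|by have [] := GP i].
Qed.

HB.instance Definition _ := isOuterMeasure.Build R X outer
  outer0 outer_ge0 le_outer outer_sigma_subadditive.

(** Approximate the open set [H] within [G] by a compact [K]. The open set [H] minus [K] contains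
    [H] minus [G]; approximate it by a compact [D]. Then [K] and [D] are disjoint in [H], and [ulim]
    is additive on them. *)
Lemma open_caratheodory G : open G -> outer.-caratheodory G.
Proof.
move=> oG; apply: le_caratheodory_measurable => A.
apply/ereal_infP => _ [H [oH AH] <-].
have oHG : open (H `&` G) by exact: openI.
apply: (@le_trans _ _ (inner (H `&` G) + outer (H `\` G))).
  apply: leeD; last by apply: le_outer; exact: setSI.
  by apply: outer_le => //; exact: setSI.
rewrite -leeBrDr ?outer_fin_num//; apply: inner_le => K cK KHG.
rewrite leeBrDr ?outer_fin_num//.
have oHK : open (H `\` K).
  by apply: openI => //; apply: closed_openC; exact: (metric_compact_closed dP).
apply: (@le_trans _ _ ((ulim K)%:E + inner (H `\` K))).
  apply: leeD => //; apply: outer_le => // x [Hx Gx]; split=> // Kx.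
  by have [] := KHG _ Kx.
rewrite addeC -leeBrDr//; apply: inner_le => D cD DHK.
rewrite leeBrDr// -EFinD -ulimU; [|exact: KB|exact: KB|].
  apply: inner_ge; first exact: compactU.
  by move=> x [/DHK[]//|/KHG[]].
by apply/seteqP; split=> // x [/DHK[]].
Qed.

Lemma borel_caratheodory A : borel A -> outer.-caratheodory A.
Proof.
apply: smallest_sub A; last exact: open_caratheodory.
split; first exact: caratheodory_measurable_set0.
- by move=> A /caratheodory_measurable_setC; rewrite setTD.
- by move=> F /caratheodory_measurable_bigcup.
Qed.

(** The same set function, typed over the Borel sets so that it can carry a measure structure. *)
Let bouter : set (borel_type X) -> \bar R := outer.

Let bouter_sigma_additive : semi_sigma_additive bouter.
Proof.
move=> F mF tF mUF.
apply: (@caratheodory_measure_sigma_additive R X outer F) => //.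
  by move=> i; apply: borel_caratheodory; exact: mF.
by apply: borel_caratheodory; exact: mUF.
Qed.

HB.instance Definition _ := isMeasure.Build _ _ _ bouter
  outer0 outer_ge0 bouter_sigma_additive.

Context (C : nat -> set X) (cC : forall k, compact (C k)).
Context (tightC : forall k n, (k <= n)%N -> (1 - k.+1%:R^-1 < mass (mu n) (C k))%R).
Context (Uoo : \oo `<=` U).

Let ulim_C k : (1 - k.+1%:R^-1 <= ulim (C k))%R.
Proof.
apply: ulim_ge; first exact: KB.
by apply: Uoo; exists k => // n /= kn; apply: ltW; exact: tightC.
Qed.

Let outer_C k : (1 - k.+1%:R^-1)%:E <= outer (C k).
Proof.
apply/ereal_infP => _ [G [oG CG] <-].
by apply: le_trans (inner_ge (@cC k) CG); rewrite lee_fin.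
Qed.

(** Tightness prevents the escape of mass: [C k] keeps at least 1 - 1/(k+1) in the limit. *)
Let bouterT : bouter setT = 1.
Proof.
apply/eqP; rewrite eq_le outer_le1/=; apply/lee_addgt0Pr => e e0.
have [k ke] : exists k, (k.+1%:R^-1 < e)%R.
  have [N _ /(_ N (leqnn N))] := near_infty_natSinv_lt (PosNum e0).
  by exists N.
rewrite -leeBlDr// -EFinB; apply: le_trans (le_outer (@subsetT _ (C k))).
by apply: le_trans (outer_C k); rewrite lee_fin lerD2l lerN2 ltW.
Qed.

HB.instance Definition _ := Measure_isProbability.Build _ _ _ bouter bouterT.

Let nu : borel_probability R X := bouter.

(** An open [G] around the complement of [B] with small excess leaves the compact set [C k] minus
    [G] inside [B]. The loss is covered by the part of [G] in [B] and the complement of [C k]. *)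
Let nu_radon : radon nu.
Proof.
move=> B mB e e0; have e2 : (0 < e / 2)%R by rewrite divr_gt0.
have [_ [G [oG BG] <-] Ge] := lb_ereal_inf_adherent e2 (outer_fin_num (~` B)).
have [k ke] : exists k, (k.+1%:R^-1 < e / 2)%R.
  have [N _ /(_ N (leqnn N))] := near_infty_natSinv_lt (PosNum e2).
  by exists N.
exists (C k `&` ~` G); split.
- by apply: compact_closedI => //; exact: open_closedC.
- by move=> x [_ Gx]; apply: contrapT => /BG.
have mG := open_borel oG; have mC : borel (C k) by exact: KB.
have mGB : borel (G `&` B) by exact: measurableI.
have sub : B `\` (C k `&` ~` G) `<=` (G `&` B) `|` ~` C k.
  move=> x [Bx nx]; have [Gx|Gx] := pselect (G x); [by left|right=> Cx].
  exact: nx.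
apply: (le_lt_trans (le_outer sub)); apply: (le_lt_trans (outer_measureU2 _ _ _)).
have GB : outer (G `&` B) < (e / 2)%:E.
  rewrite -(outer_open oG) (borel_caratheodory mB) in Ge.
  have GcB : G `&` ~` B = ~` B by apply/setIidr.
  move: Ge; rewrite GcB addeC lteD2lE//; exact: outer_fin_num.
have CE : outer (~` C k) <= (k.+1%:R^-1)%:E.
  have := probability_setC (nu : probability (borel_type X) R) mC.
  rewrite -[X in X = _]/(outer _) -[X in _ = 1 - X]/(outer _) => ->.
  rewrite leeBlDr ?outer_fin_num// addeC -leeBlDr//.
  by rewrite -EFinB; exact: outer_C.
rewrite [e in e%:E]splitr EFinD; apply: lteD => //.
by rewrite (le_lt_trans CE)// lte_fin.
Qed.

Let nu_open_le G : open G -> (mass nu G <= ulim G)%R.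
Proof.
move=> oG; rewrite -lee_fin -massE; last exact: open_borel.
by apply: le_trans (inner_le_ulim oG); rewrite -outer_open.
Qed.

(** Since [nu_open_le] is one-sided, so is this bound; applying it to [f] and to its opposite gives
    convergence. *)
Let integral_lower (f : X -> R) (M e : R) : (0 < e)%R -> continuous f ->
  (forall x, `|f x| <= M)%R ->
  \forall n \near U, (borel_integral nu f - e < borel_integral (mu n) f)%R.
Proof.
move=> e0 cf fM; have e2 : (0 < e / 2)%R by rewrite divr_gt0.
have [N MN] : exists N, (M *+ 2 <= N%:R * (e / 2))%R.
  exists (Num.bound `|M *+ 2 / (e / 2)|)%R; rewrite -ler_pdivrMr//.
  by rewrite ltW// (le_lt_trans (ler_norm _))// archi_boundP ?normr_ge0.
have [A oA Ab] := integral_layer_cake e2 cf fM MN.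
have cvgS : (\sum_(i < N) mass (mu n) (A i))%R @[n --> U]
    --> (\sum_(i < N) ulim (A i))%R.
  elim: N {MN Ab} => [|N IHN].
    by under eq_cvg do rewrite big_ord0; rewrite big_ord0; exact: cvg_cst.
  under eq_cvg do rewrite big_ord_recr/=; rewrite big_ord_recr/=.
  by apply: cvgD => //; apply: ulim_cvg; exact: open_borel.
have cvgS2 : (e / 2 * (\sum_(i < N) mass (mu n) (A i)) - M)%R @[n --> U]
    --> (e / 2 * (\sum_(i < N) ulim (A i)) - M)%R.
  by apply: cvgB; [apply: cvgM => //; exact: cvg_cst|exact: cvg_cst].
have nuS : (e / 2 * (\sum_(i < N) mass nu (A i)) - M <=
    e / 2 * (\sum_(i < N) ulim (A i)) - M)%R.
  rewrite lerD2r ler_pM2l//; apply: ler_sum => i _; exact: nu_open_le.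
have /andP[_ nub] := Ab nu.
have lt1 : (borel_integral nu f - e < e / 2 * (\sum_(i < N) ulim (A i)) - M)%R.
  by move: nub nuS e0; lra.
apply: filterS (cvgr_gt _ cvgS2 _ lt1) => n ltn.
have /andP[len _] := Ab (mu n).
apply: (lt_le_trans ltn).
 exact: len.
Qed.

Lemma tight_ultrafilter_cvg :
  exists2 nu : borel_probability R X, radon nu & mu @ U --> nu.
Proof.
exists nu => // N [[[n f] e] [/= e0 fb] nuN].
suff /(filterS _) : \forall m \near U, weak_basic nu (n, f, e) (mu m).
  by apply => m /nuN.
apply: filter_forall_ltn => i /fb[cf [M fM]].
have cNf : continuous (fun x => - f i x)%R by move=> x; apply: cvgN; exact: cf.
have NfM x : (`|- f i x| <= M)%R by rewrite normrN.
have := integral_lower e0 cNf NfM; apply: filterS2 (integral_lower e0 cf fM).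
have intN (xi : borel_probability R X) :
    borel_integral xi (fun x => - f i x)%R = (- borel_integral xi (f i))%R.
  rewrite /borel_integral -mulN1r -RintegralZl//.
    by apply: eq_Rintegral => x _; rewrite mulN1r.
  by apply: (@bounded_borel_integrable _ _ _ _ M) => //; exact: continuous_borel.
move=> m /=; rewrite !intN ltr_norml; lra.
Qed.

End limit_measure.
(** * The tree of measures *)

Lemma set_type_nbhs (T : topologicalType) (A : set T) (x : set_type A)
    (N : set (set_type A)) :
  nbhs x N <-> exists2 W, nbhs (set_val x) W & set_val @^-1` W `<=` N.
Proof.
split=> [|[W xW WN]]; last by apply: filterS WN _; exact: initial_continuous xW.
rewrite nbhsE => -[_ [/set_type_open[W oW ->] Wx] WN]; exists W => //.
by exists W.
Qed.

Section radon_neighborhoods.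
Context {R : realType} {X : ptopologicalType} {d : X -> X -> R}.
Context (dP : compatible_metric d).
Implicit Types (mu : borel_probability R X) (K O : set X) (c : R).

Lemma mass_gt0_neq0 mu K c : 0 <= c -> c < mass mu K -> K !=set0.
Proof.
move=> c0 cK; apply/set0P/negP => /eqP K0.
by move: cK; rewrite K0 mass0 ltNge c0.
Qed.

(** The integral of one Urysohn function is at least the mass of [K] for [mu] and at most the mass
    of [O] for [nu]. *)
Lemma nbhs_mass_gt mu K O c : compact K -> open O -> K `<=` O ->
  0 <= c -> c < mass mu K -> nbhs mu [set nu | c < mass nu O].
Proof.
move=> cK oO KO c0 cmu; have K0 := mass_gt0_neq0 c0 cmu.
have mK : borel K by apply: closed_borel; exact: (metric_compact_closed dP).
have [f [cf f01 f1 f0]] := metric_urysohn dP cK K0 oO KO.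
exists (1%N, fun=> f, mass mu K - c) => /=.
  split=> /=; first by rewrite subr_gt0.
  move=> _ _; split=> //; exists 1 => x; have /andP[fx0 fx1] := f01 x.
  by rewrite ger0_norm.
move=> nu /= /(_ 0%N isT); rewrite ltr_norml.
have := mass_le_integral mu mK cf f01 f1.
have := integral_le_mass nu (open_borel oO) cf f01 f0; rewrite /=; lra.
Qed.

Lemma radon_inner_mass mu O c : radon mu -> open O -> c < mass mu O ->
  exists K, [/\ compact K, K `<=` O & c < mass mu K].
Proof.
move=> rmu oO cO; have mO := open_borel oO.
have [|K [cK KO muOK]] := rmu _ mO (mass mu O - c); first by rewrite subr_gt0.
exists K; split=> //; have mK : borel K.
  by apply: closed_borel; exact: (metric_compact_closed dP).
have mOK : borel (O `\` K) by exact: measurableD.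
move: muOK; rewrite massE// lte_fin.
have : mass mu O = mass mu K + mass mu (O `\` K).
  by rewrite -massU// ?setDIK//; congr mass; rewrite setDUK.
lra.
Qed.

Lemma weak_regular mu (N : set (borel_probability R X)) : nbhs mu N ->
  exists2 M, nbhs mu M & closure M `<=` N.
Proof.
move=> [[[n f] e] [/= e0 fb] muN].
have fb2 : weak_index (n, f, e / 2) by split=> //=; rewrite divr_gt0.
exists (weak_basic mu (n, f, e / 2)); first by exists (n, f, e / 2).
move=> nu clnu; apply: muN => i /= ni.
have [xi [/(_ _ ni)/= h1 /(_ _ ni)/= h2]] :
  weak_basic mu (n, f, e / 2) `&` weak_basic nu (n, f, e / 2) !=set0.
  by apply: clnu; exists (n, f, e / 2).
move: h1 h2; rewrite !ltr_norml; lra.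
Qed.

Lemma radon_regular (x : radon_probability R X) (O : set (radon_probability R X)) :
  open O -> O x -> exists G, [/\ open G, G x & closure G `<=` O].
Proof.
move=> oO Ox; have /set_type_nbhs[W /weak_regular[M xM MW] WO] : nbhs x O.
  exact: open_nbhs_nbhs.
pose N : set (radon_probability R X) := set_val @^-1` M.
exists (interior N); split; first exact: open_interior.
  by apply/set_type_nbhs; exists M.
move=> y My; apply: WO; apply: MW => B yB.
have [z [/interior_subset Mz Bz]] : interior N `&` (set_val @^-1` B) !=set0.
  by apply: My; apply/set_type_nbhs; exists B.
by exists (set_val z).
Qed.

End radon_neighborhoods.

Section tree.
Context {R : realType} {X : ptopologicalType} {d : X -> X -> R}.
Context (dP : compatible_metric d).
Let T := radon_probability R X.
Context (A : set T) (U : nat -> set T).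
Context (oU : forall n, open (U n)).
Context (dU : forall n O, open O -> A `&` O !=set0 -> A `&` O `&` U n !=set0).

Let c (k : nat) : R := 1 - k.+1%:R^-1.

Let c_ge0 k : 0 <= c k.
Proof. by rewrite subr_ge0 invf_le1// ler1n. Qed.

Let c_lt1 k : c k < 1.
Proof. by rewrite ltrBlDr ltrDl invr_gt0. Qed.

(* [cpt k] carries more than [c k] of the mass of [point]; [opn k] is an open set
   to which the [cpt k] of all descendants are confined as soon as
   [k <= bound]. *)
Record node := Node {
  bound : nat;
  point : T;
  nbd : set T;
  cpt : nat -> set X;
  opn : nat -> set X }.

Definition valid (s : node) : Prop :=
  [/\ A (point s), open (nbd s), nbd s (point s) &
   forall k, [/\ compact (cpt s k), open (opn s k), cpt s k `<=` opn s k &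
                 c k < mass (set_val (point s)) (cpt s k)]].

(* The confinement to the thickening of [cpt s k] starts at [k <= bound t] and
   not at the depth of [t]: with [k] fixed, all but finitely many of the
   children of [s] are confined, and that makes [hull] compact. *)
Definition successor (s : node) (j : nat) (t : node) : Prop :=
  [/\ valid t, bound t = (bound s + j).+1,
      closure (nbd t) `<=` nbd s,
      forall i, (i < bound t)%N -> closure (nbd t) `<=` U i &
      forall k, (k <= bound t)%N -> opn t k `<=` opn s k `&` thick d (cpt s k) j].

Let cpt_neq0 s k : valid s -> cpt s k !=set0.
Proof. by move=> [_ _ _ /(_ k)[_ _ _]]; exact: mass_gt0_neq0. Qed.

Let dense_prefix n O : open O -> A `&` O !=set0 ->
  A `&` O `&` [set x | forall i, (i < n)%N -> U i x] !=set0.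
Proof.
move=> oO AO; elim: n => [|n [x [[Ax Ox] Ux]]].
  by have [x AOx] := AO; exists x; split.
have oV : open (O `&` interior [set x | forall i, (i < n)%N -> U i x]).
  by apply: openI => //; exact: open_interior.
have [|y [[Ay [Oy /interior_subset Vy]] Uy]] := @dU n _ oV.
  exists x; do 2?split=> //; apply: filter_forall_ltn => i ni.
  by apply: open_nbhs_nbhs; split=> //; exact: Ux.
exists y; do 2?split=> //; move=> i; rewrite ltnS leq_eqVlt => /predU1P[->//|].
exact: Vy.
Qed.

Lemma node_exists b (x : T) (G : set T) (O : nat -> set X) :
  A x -> open G -> G x -> (forall k, open (O k)) ->
  (forall k, c k < mass (set_val x) (O k)) ->
  exists s, [/\ valid s, bound s = b, point s = x, nbd s = G & opn s = O].
Proof.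
move=> Ax oG Gx oO cO.
have /choice[K KP] : forall k, exists K,
    [/\ compact K, K `<=` O k & c k < mass (set_val x) K].
  by move=> k; apply: (radon_inner_mass dP) => //; exact: set_valP.
exists (Node b x G K O); split=> //; split=> // k.
by have [cK KO cmu] := KP k; split.
Qed.

(** The strict mass bounds of [s] persist on the smaller sets [W k] for nearby measures. Density
    gives such a measure in [A] and in the first [b] sets [U i], regularity shrinks its
    neighborhood, and inner regularity provides the compact sets. *)
Lemma successor_exists s j : valid s -> exists t, successor s j t.
Proof.
move=> vs; have [As oG Gs sP] := vs; pose b := (bound s + j).+1.
pose W k := opn s k `&` thick d (cpt s k) j.
have oW k : open (W k).
  have [_ oO _ _] := sP k.
  by apply: openI => //; apply: thick_open => //; exact: cpt_neq0.
have WN : nbhs (point s)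
    [set y : T | forall k, (k < b.+1)%N -> c k < mass (set_val y) (W k)].
  apply: filter_forall_ltn => k _; have [cK oO KO cmu] := sP k.
  apply/set_type_nbhs; exists [set nu | c k < mass nu (W k)] => //.
  apply: (@nbhs_mass_gt _ _ _ dP _ (cpt s k)) => // x Kx; split; first exact: KO.
  exact: sub_thick.
pose N := interior
  [set y : T | forall k, (k < b.+1)%N -> c k < mass (set_val y) (W k)].
have [||x [[Ax [Nx Gx]] Ux]] := @dense_prefix b (N `&` nbd s).
- by apply: openI => //; exact: open_interior.
- by exists (point s).
have [G [oG' G'x G'sub]] : exists G, [/\ open G, G x &
    closure G `<=` nbd s `&` [set x | forall i, (i < b)%N -> U i x]].
  have /(_ x)[] := fun x => @radon_regular R X x
    (nbd s `&` interior [set x | forall i, (i < b)%N -> U i x]).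
  - by apply: openI => //; exact: open_interior.
  - split=> //; apply: filter_forall_ltn => i ib.
    by apply: open_nbhs_nbhs; split=> //; exact: Ux.
  move=> G [oG' G'x G'sub]; exists G; split=> // y /G'sub[sy /interior_subset].
  by split.
(* Only finitely many mass conditions together define a neighborhood, so beyond [b] the compact sets
   are chosen afresh in the whole space. *)
pose O k := if (k < b.+1)%N then W k else setT.
have [||t [vt bt pt nt ot]] := @node_exists b x G O Ax oG' G'x.
- by move=> k; rewrite /O; case: ifP => // _; exact: openT.
- move=> k; rewrite /O; case: ifPn => [kb|_]; last by rewrite massT.
  exact: (interior_subset Nx).
exists t; split=> //.
- by rewrite nt => y /G'sub[].
- by rewrite nt bt => i ib y /G'sub[_]; exact.
- by move=> k; rewrite bt -ltnS ot /O => ->.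
Qed.

Context (step : node -> nat -> node).
Context (stepP : forall s j, valid s -> successor s j (step s j)).

Let step_valid s j : valid s -> valid (step s j).
Proof. by move=> /(stepP j)[]. Qed.

Let step_opn s j k : valid s -> (k <= bound (step s j))%N ->
  opn (step s j) k `<=` opn s k.
Proof. by move=> /(stepP j)[_ _ _ _ h] /h + x => /[apply] -[]. Qed.

Let step_thick s j k : valid s -> (k <= bound (step s j))%N ->
  opn (step s j) k `<=` thick d (cpt s k) j.
Proof. by move=> /(stepP j)[_ _ _ _ h] /h + x => /[apply] -[]. Qed.

Let bound_step s j : valid s -> bound (step s j) = (bound s + j).+1.
Proof. by move=> /(stepP j)[]. Qed.

(** The union of the [k]-th compact sets over all nodes at depth at most [n] below [s]; at the root
    this is L^k_n. *)
Fixpoint hull k s n : set X :=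
  if n is m.+1 then cpt s k `|` \bigcup_j hull k (step s j) m else cpt s k.

Let hull_opn k s n : valid s -> (k <= bound s)%N -> hull k s n `<=` opn s k.
Proof.
elim: n s => [|n IHn] s vs ks /=; first by have [_ _ _ /(_ k)[]] := vs.
move=> x [|[j _ hx]]; first by have [_ _ _ /(_ k)[_ _ +] _] := vs; exact.
have kj : (k <= bound (step s j))%N.
  by rewrite bound_step// (leq_trans ks)// leqW// leq_addr.
exact: (step_opn vs kj (IHn _ (step_valid j vs) kj _ hx)).
Qed.

(** A child of index j >= k has bound at least [k], so its hull lies in the thickening of [cpt s k]
    of index [j]. *)
Let hull_compact k s n : valid s -> compact (hull k s n).
Proof.
elim: n s => [|n IHn] s vs /=; first by have [_ _ _ /(_ k)[]] := vs.
apply: (@compact_bigcup_thick _ _ _ dP _ _ k).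
- by have [_ _ _ /(_ k)[]] := vs.
- exact: cpt_neq0.
- by move=> j; apply: IHn; exact: step_valid.
move=> j kj x hx; have kb : (k <= bound (step s j))%N.
  by rewrite bound_step// leqW// (leq_trans kj)// leq_addl.
exact: (step_thick vs kb (hull_opn (step_valid j vs) kb hx)).
Qed.

Let hullS k s n : hull k s n `<=` hull k s n.+1.
Proof.
elim: n s => [|n IHn] s x; first by left.
by case=> [|[j _ hx]]; [left|right; exists j => //; exact: IHn].
Qed.

Let cpt_hull k s t : cpt (foldl step s t) k `<=` hull k s (size t).
Proof.
elim: t s => [|j t IHt] s x Kx; first exact: Kx.
by right; exists j => //; exact: IHt.
Qed.

Context (r : node) (vr : valid r).

Let path (f : nat -> nat) n := foldl step r (mkseq f n).

Let pathS f n : path f n.+1 = step (path f n) (f n).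
Proof. by rewrite /path mkseqS foldl_rcons. Qed.

Let path_valid f n : valid (path f n).
Proof. by elim: n => [//|n IHn]; rewrite pathS; exact: step_valid. Qed.

Let path_bound f n : (n <= bound (path f n))%N.
Proof.
elim: n => [//|n IHn]; rewrite pathS bound_step; last exact: path_valid.
by rewrite ltnS (leq_trans IHn)// leq_addr.
Qed.

Let path_opn f k m n : (k <= m)%N -> (m <= n)%N ->
  opn (path f n) k `<=` opn (path f m) k.
Proof.
move=> km; elim: n => [|n IHn]; first by rewrite leqn0 => /eqP->.
rewrite leq_eqVlt => /predU1P[->//|mn] x; rewrite pathS => h.
apply: (IHn mn); apply: step_opn h; first exact: path_valid.
rewrite -pathS; exact: leq_trans km (leq_trans (ltnW mn) (path_bound f n.+1)).
Qed.

Let path_thick f k m n : (k <= m)%N -> (m < n)%N ->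
  cpt (path f n) k `<=` thick d (cpt (path f m) k) (f m).
Proof.
move=> km mn x Kx; apply: step_thick; first exact: path_valid.
  by rewrite -pathS; exact: leq_trans (leqW km) (path_bound f m.+1).
rewrite -pathS; apply: (@path_opn f k m.+1 n) => //; first exact: leqW.
by have [_ _ _ /(_ k)[_ _ +] _] := path_valid f n; exact.
Qed.

Let path_nbd f m n : (m <= n)%N -> nbd (path f n) `<=` nbd (path f m).
Proof.
elim: n => [|n IHn]; first by rewrite leqn0 => /eqP->.
rewrite leq_eqVlt => /predU1P[->//|mn] x; rewrite pathS => h; apply: (IHn mn).
have [_ _ + _ _] := stepP (f n) (path_valid f n); apply.
exact: subset_closure.
Qed.

(** On a branch, the [k]-th compact set lies in the thickenings of its predecessors from depth [k]
    on, hence in those of the hulls. If [f] dominates the function from [compact_branch], it falls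
    into the compact set found there. *)
Let tight_path : hereditarily_baire (hyperspace X) ->
  exists f, exists2 C : nat -> set X, forall k, compact (C k) &
  forall k n, (k <= n)%N -> cpt (path f n) k `<=` C k.
Proof.
move=> hB.
(* Depths are shifted by [k], because a node at depth at least [k] has bound at least [k], which
   guarantees confinement. *)
have /choice[g gP] : forall k, exists g, exists2 C : set X, compact C &
    forall n, hull k r (k + n) `&` [set x | forall m, (m < n)%N ->
      cthick d (hull k r (k + m)) (g m) x] `<=` C.
  move=> k; apply: (compact_branch dP) => //.
  - by move=> n; exact: hull_compact.
  - have [x Kx] := cpt_neq0 k vr; exists x.
    by case: (k + 0)%N => [|n]; [|left].
  - by move=> n; rewrite addnS; exact: hullS.
have /choice[C CP] : forall k, exists C : set X, compact C /\
    forall n, hull k r (k + n) `&` [set x | forall m, (m < n)%N ->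
      cthick d (hull k r (k + m)) (g k m) x] `<=` C.
  by move=> k; have [C cC CP] := gP k; exists C.
(* The sets [hull k r n] do not depend on a branch, so that one branch can
   dominate all the [g k] at once. *)
pose f n := \max_(k < n.+1) g k (n - k)%N.
have gf k m : (g k m <= f (k + m))%N.
  have kkm : (k < (k + m).+1)%N by rewrite ltnS leq_addr.
  have := @leq_bigmax _ (fun k' : 'I_(k + m).+1 => g k' (k + m - k')%N) (Ordinal kkm).
  by rewrite /= addKn.
exists f, C => [k|k n]; first by have [] := CP k.
move=> /subnKC <-; move: (n - k)%N => {}n x Kx; have [_ /(_ n)] := CP k; apply.
have sub m : cpt (path f m) k `<=` hull k r m.
  by have := @cpt_hull k r (mkseq f m); rewrite size_mkseq.
split; first exact: sub.
move=> m mn; apply: thick_cthick.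
apply: (thick_subset dP _ (sub (k + m)%N) (gf k m)).
  by apply: cpt_neq0; exact: path_valid.
by apply: path_thick Kx; [exact: leq_addr|rewrite ltn_add2l].
Qed.

Lemma tree_limit : hereditarily_baire (hyperspace X) -> closed A ->
  exists x : T, [/\ A x, nbd r x & forall i, U i x].
Proof.
move=> hB cA; have [f [C cC CP]] := tight_path hB.
have [V [UV ooV]] := ultraFilterLemma (@eventually_filter).
pose mu n : borel_probability R X := set_val (point (path f n)).
have KB (K : set X) : compact K -> borel K.
  by move=> cK; apply: closed_borel; exact: (metric_compact_closed dP).
have [|nu rnu munu] := @tight_ultrafilter_cvg R X d dP mu V UV C cC _ ooV.
  move=> k n kn; have [_ _ _ /(_ k)[cK _ _ cmu]] := path_valid f n.
  apply: (lt_le_trans cmu); apply: le_mass; [exact: KB|exact: KB|].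
  exact: CP.
pose x : T := exist _ nu (mem_set rnu).
(* [V] contains all tails, so the limit lies in every closed set containing a tail of the branch. *)
have xF F m : closed F -> (forall n, (m <= n)%N -> F (point (path f n))) -> F x.
  move=> cF Fp; apply: cF => B /set_type_nbhs[W xW WB].
  have VW : V [set n | W (mu n) /\ (m <= n)%N].
    by apply: filterI; [exact: munu|apply: ooV; exists m].
  have [n [Wn mn]] := @filter_ex _ V _ _ VW.
  by exists (point (path f n)); split; [exact: Fp|exact: WB].
have xG n : closure (nbd (path f n)) x.
  apply: (xF _ n); first exact: closed_closure.
  move=> m nm; apply: subset_closure; apply: (path_nbd nm).
  by have [] := path_valid f m.
exists x; split.
- by apply: (xF _ 0%N) => // n _; have [] := path_valid f n.
- have := xG 1%N; rewrite pathS.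
  by have [_ _ + _ _] := stepP (f 0%N) (path_valid f 0); exact.
(* The node at depth i+1 has bound greater than [i], so the closure of its neighborhood lies in
   [U i]. *)
move=> i; have := xG i.+1; have ib := path_bound f i.+1; rewrite pathS in ib *.
by have [_ _ _ + _] := stepP (f i) (path_valid f i); exact.
Qed.

End tree.
(** * Density of the Radon measures *)

Section finite_range_law.
Context {R : realType} {X : ptopologicalType}.
Context (mu : borel_probability R X) (g : borel_type X -> borel_type X).
Context (mg : measurable_fun setT g).

HB.instance Definition _ := isMeasurableFun.Build _ _ _ _ g mg.

Let nu : borel_probability R X :=
  distribution (mu : probability (borel_type X) R) g.

Let finite_range_law_radon : finite_set (range g) -> radon nu.
Proof.
move=> fg B mB e e0; exists (B `&` range g); split=> //.
- by apply: finite_compact; exact: finite_setIr.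
- rewrite [X in (X < _)%E](_ : _ = 0%E) ?lte_fin//.
  rewrite /nu /= /distribution /pushforward (_ : _ @^-1` _ = set0) ?measure0//.
  by apply/seteqP; split=> // x [Bx]; apply; split=> //; exists x.
Qed.

Let finite_range_law_integral (f : X -> R) M : continuous f ->
  (forall x, `|f x| <= M) -> borel_integral nu f = borel_integral mu (f \o g).
Proof.
move=> cf fM; rewrite /borel_integral /Rintegral; congr fine.
have mf := continuous_borel cf.
rewrite /nu (integral_pushforward mg)//.
  exact/measurable_EFinP.
apply: (@bounded_borel_integrable _ _ mu (f \o g) M) => [|x]; last exact: fM.
exact: measurableT_comp mf mg.
Qed.

Lemma finite_range_law : finite_set (range g) ->
  exists2 xi : borel_probability R X, radon xi &
  forall (f : X -> R) M, continuous f -> (forall x, `|f x| <= M) ->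
    borel_integral xi f = borel_integral mu (f \o g).
Proof. by move=> fg; exists nu; [exact: finite_range_law_radon|]. Qed.

End finite_range_law.

Section radon_dense.
Context {R : realType} {X : ptopologicalType}.

(** A Borel map [g] of finite range that changes each test function by at most [e / 2] sends [mu] to
    a Radon measure in the neighborhood. *)
Lemma radon_dense (mu : borel_probability R X) (N : set (borel_probability R X)) :
  nbhs mu N -> exists2 nu, radon nu & N nu.
Proof.
move=> [[[n f] e] [/= e0 fb] muN]; have e2 : 0 < e / 2 by rewrite divr_gt0.
have [M fM] : exists M, forall i, (i < n)%N -> forall x, `|f i x| <= M.
  elim: n fb {muN} => [|n IHn] fb; first by exists 0.
  have [|M IM] := IHn; first by move=> i ni; apply: fb; exact: leqW.
  have [_ [M' IM']] := fb n (ltnSn n).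
  exists (Num.max M M') => i; rewrite ltnS leq_eqVlt => /predU1P[->|/IM h] x.
    by rewrite le_max IM' orbT.
  by rewrite le_max h.
have [m MN] : exists m, M *+ 2 <= m%:R * (e / 2).
  exists (Num.bound `|M *+ 2 / (e / 2)|); rewrite -ler_pdivrMr//.
  by rewrite ltW// (le_lt_trans (ler_norm _))// archi_boundP ?normr_ge0.
(* [key x] records which multiples of [e / 2] lie below each [f i x + M]. Points with equal keys
   have values within [e / 2], and [g] picks one point per key. *)
pose key (x : X) : {set 'I_n * 'I_m} :=
  [set p : 'I_n * 'I_m | p.2.+1%:R * (e / 2) < f p.1 x + M]%SET.
pose g x : X := get [set y | key y = key x].
have keyg x : key (g x) = key x.
  exact: (@getPex _ [set y | key y = key x]) (ex_intro _ x erefl).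
have gkey x y : key x = key y -> g x = g y by rewrite /g => ->.
have fg i x : (i < n)%N -> `|f i x - f i (g x)| <= e / 2.
  move=> ni; have bnd z : 0 <= f i z + M <= m%:R * (e / 2).
    have := fM i ni z; rewrite ler_norml.
    by move: MN; rewrite mulr2n; move: (m%:R * _) => q; lra.
  have /andP[x1 x2] := layer_cake_bounds e2 (bnd x).
  have /andP[y1 y2] := layer_cake_bounds e2 (bnd (g x)).
  have sE : \sum_(j < m) ((j.+1%:R * (e / 2) < f i x + M)%R : nat)%:R =
      \sum_(j < m) ((j.+1%:R * (e / 2) < f i (g x) + M)%R : nat)%:R :> R.
    apply: eq_bigr => j _; congr ((nat_of_bool _)%:R).
    have /finset.setP/(_ (Ordinal ni, j)) := keyg x.
    by rewrite !finset.inE.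
  by move: x1 x2 y1 y2; rewrite sE ler_norml; lra.
(* Membership of one pair in [key x] is an open condition on [x], so the finitely many fibers are
   Borel; preimages under [g] are unions of fibers. *)
have mkey v : borel [set x | key x = v].
  rewrite (_ : mkset _ = \bigcap_(p in [set: 'I_n * 'I_m])
    [set x | (p \in key x) = (p \in v)]); last first.
    apply/seteqP; split=> [x /= xv p _|x xv] /=; first by rewrite /= xv.
    by apply/finset.setP => p; exact: xv.
  apply: (@fin_bigcap_measurable _ (borel_type X)); first exact: finite_finset.
  move=> p _; have op : open [set x | p \in key x].
    have [/continuousP cf _] := fb p.1 (ltn_ord p.1).
    rewrite (_ : mkset _ = f p.1 @^-1` `](p.2.+1%:R * (e / 2) - M), +oo[%classic).
      by apply: cf; exact: interval_open.
    by apply/seteqP; split=> x /=; rewrite in_itv/= andbT finset.inE ltrBlDr.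
  case: (p \in v); first exact: open_borel.
  rewrite (_ : mkset _ = ~` [set x | p \in key x]).
    by apply: measurableC; exact: open_borel.
  by apply/seteqP; split=> x /= => [->//|/negP/negbTE].
have mg : measurable_fun (setT : set (borel_type X)) (g : borel_type X -> borel_type X).
  move=> _ B _; rewrite setTI.
  rewrite (_ : _ @^-1` _ = \bigcup_(v in [set v | exists2 x, key x = v & B (g x)])
      [set x | key x = v]).
    apply: (@fin_bigcup_measurable _ (borel_type X)); first exact: finite_finset.
    by move=> v _; exact: mkey.
  apply/seteqP; split=> [x Bx|x [_ [y <- By] xy]].
    by exists (key x) => //; exists x.
  by rewrite /= (gkey x y).
have rg : finite_set (range g).
  apply: (@sub_finite_set _ _
    [set get [set y | key y = v] | v in [set: {set 'I_n * 'I_m}]]).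
    by move=> _ [x _ <-]; exists (key x).
  by apply: finite_image; exact: finite_finset.
have [nu rnu nuE] := finite_range_law mu mg rg; exists nu => //.
apply: muN => i /= ni; have [cf _] := fb i ni.
rewrite (nuE _ M cf (fM i ni)) /borel_integral.
have If : (mu : probability (borel_type X) R).-integrable setT (EFin \o f i).
  by apply: (@bounded_borel_integrable R X mu _ M);
    [exact: continuous_borel|exact: fM].
have mfg : measurable_fun (setT : set (borel_type X)) (f i \o g : borel_type X -> R).
  exact: measurableT_comp (continuous_borel cf) mg.
have Ifg : (mu : probability (borel_type X) R).-integrable setT (EFin \o (f i \o g)).
  by apply: (@bounded_borel_integrable R X mu _ M) => // x; exact: fM.
rewrite -(RintegralB measurableT If Ifg).
have IB : (mu : probability (borel_type X) R).-integrable setT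
    (EFin \o (fun x => f i x - f i (g x))).
  apply: (@bounded_borel_integrable R X mu _ (e / 2)) => [|x]; last exact: fg.
  by apply: measurable_funB => //; exact: continuous_borel.
apply: le_lt_trans (le_normr_Rintegral measurableT IB) _.
rewrite (@le_lt_trans _ _
  (\int[(mu : probability (borel_type X) R)]_(x in setT) (e / 2)))//.
  apply: le_Rintegral => //.
  - apply: (@bounded_borel_integrable R X mu _ (e / 2)) => [|x].
      apply: measurableT_comp => //.
      by apply: measurable_funB => //; exact: continuous_borel.
    by rewrite normr_id; exact: fg.
  - apply: (@bounded_borel_integrable R X mu _ (e / 2)) => // x.
    by rewrite ger0_norm// ltW.
  - by move=> x _; exact: fg.
rewrite Rintegral_cst// -[fine _]/(mass mu setT) massT mulr1; lra.
Qed.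

End radon_dense.

(** * Baire properties of the Radon measures and of all measures *)

Lemma radon_hereditarily_baire (R : realType) (X : ptopologicalType) :
  metrizable R X -> hereditarily_baire (hyperspace X) ->
  hereditarily_baire (radon_probability R X).
Proof.
move=> [d dP] hB; apply/hereditarily_baireP => A U cA oU dU O oO [x [Ax Ox]].
(* Validity is a premise inside [S], so that [step] can be chosen on all nodes. *)
pose S (p : node * nat) t :=
  valid A p.1 -> successor (d := d) A U p.1 p.2 t.
have /choice[step stepP] : forall p, exists t, S p t.
  move=> [s j]; have [vs|ns] := pselect (valid A s); last by exists s => /ns.
  by have [t st] := successor_exists dP oU dU j vs; exists t.
have massTgt k : 1 - k.+1%:R^-1 < mass (set_val x) setT.
  by rewrite massT ltrBlDr ltrDl invr_gt0.
(* The root has neighborhood [O] and imposes no confinement: its sets [opn] are the whole space. *)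
have [r [vr _ _ rO _]] :=
  node_exists dP 0 Ax oO Ox (fun=> openT) massTgt.
have [y [Ay Oy Uy]] := tree_limit dP (step := fun s j => step (s, j))
  (fun s j => stepP (s, j)) vr hB cA.
exists y; split; last by move=> n _; exact: Uy.
by rewrite rO in Oy.
Qed.

(** Dense open sets have dense traces on [D]: a nonempty open set meets [U n] in a nonempty open
    set, which [D] meets in turn. *)
Lemma baire_of_dense_subspace (T : topologicalType) (D : set T) :
  (forall (x : T) N, nbhs x N -> D `&` N !=set0) ->
  baire_space (set_type D) -> baire_space T.
Proof.
move=> dD bD U dU O O0 oO.
have D_dense V : V !=set0 -> open V -> exists x : set_type D, V (set_val x).
  move=> [x Vx] oV; have [y [Dy Vy]] := dD x V (open_nbhs_nbhs (conj oV Vx)).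
  by exists (exist _ y (mem_set Dy)).
have [|||x [Ox Ux]] := bD (fun n => set_val @^-1` U n) _ (set_val @^-1` O).
- move=> n; have [oUn dUn] := dU n; split.
    by apply/set_type_open; exists (U n).
  move=> W [w Ww] /set_type_open[V oV WV]; rewrite WV in Ww *.
  have [||y Vy] := D_dense (V `&` U n); last by exists y.
    by apply: dUn => //; exists (set_val w).
  exact: openI.
- have [x Ox] := D_dense O O0 oO; by exists x.
- by apply/set_type_open; exists O.
by exists (set_val x).
Qed.

Theorem theorem5p1 (R : realType) (X : ptopologicalType) :
  separable X -> metrizable R X ->
  hereditarily_baire (hyperspace X) ->
  hereditarily_baire (radon_probability R X) /\
  baire_space (borel_probability R X).
Proof.
move=> _ mX hB; have hBr := radon_hereditarily_baire mX hB; split=> //.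
apply: (@baire_of_dense_subspace _ (@radon R X)).
  by move=> mu N /radon_dense[nu rnu Nnu]; exists nu.
move=> U oU; have /hereditarily_baireP hP := hBr.
move=> O O0 oO; have [|||x [[_ Ox] Ux]] := hP setT U closedT _ _ O oO.
- by move=> n; have [] := oU n.
- move=> n V oV; rewrite !setTI => V0; have [_ dUn] := oU n; exact: dUn.
- by rewrite setTI.
by exists x.
Qed.
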